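(* Let $\sigma$ be a SODE on $M$ and let $\pi\colon P^\sigma\to M^1$ be the $G$-structure of linear frames of $M^1$ adapted to $\sigma$. The adjoint bundle of $P^\sigma$ can be identified with the vector subbundle $\mathrm{ad}P^\sigma\subseteq T^*(M^1)\otimes T(M^1)$ of all endomorphisms $E\colon T(M^1)\to T(M^1)$ such that $$E(T^0(M^1))=\{0\},\quad E(T^-(M^1))\subseteq T^-(M^1),\quad E(T^+(M^1))\subseteq T^+(M^1),$$ and such that $H^\sigma\circ\varepsilon^{-1}$ conjugates $E|_{T^-(M^1)}$ and $E|_{T^+(M^1)}$, i.e. $$E|_{T^-(M^1)}\circ H^\sigma\circ\varepsilon^{-1}=H^\sigma\circ\varepsilon^{-1}\circ E|_{T^+(M^1)}.$$
   Context: $M$ is a connected smooth manifold of dimension $n$; $M^0=\mathbb{R}\times M$ with projections $p\colon M^0\to\mathbb{R}$, $p'\colon M^0\to M$; $M^r=J^r(\mathbb{R},M)$ is the manifold of $r$-jets of smooth maps $\mathbb{R}\to M$, with projections $p^{rs}\colon M^r\to M^s$. Coordinates $(x^i)$ on $M$ induce coordinates $(t,x^i,\dot x^i)$ on $M^1$ and $(t,x^i,\dot x^i,\ddot x^i)$ on $M^2$. The summation convention is used. A SODE on $M$ is a smooth section $\sigma\colon M^1\to M^2$ of $p^{21}$; in coordinates $F^i=\ddot x^i\circ\sigma$. Put $X^\sigma=\frac{\partial}{\partial t}+\dot x^i\frac{\partial}{\partial x^i}+F^i\frac{\partial}{\partial\dot x^i}$ (globally defined), $X^\sigma_i=\frac{\partial}{\partial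 x^i}+\frac12\frac{\partial F^j}{\partial\dot x^i}\frac{\partial}{\partial\dot x^j}$, $\omega^i=dx^i-\dot x^idt$. There is a coordinate-independent decomposition $T(M^1)=T^0(M^1)\oplus T^-(M^1)\oplus T^+(M^1)$ with $T^0(M^1)=\langle X^\sigma\rangle$, $T^-(M^1)=\langle X^\sigma_1,\dots,X^\sigma_n\rangle$, $T^+(M^1)=V(p^{10})=\langle\partial/\partial\dot x^1,\dots,\partial/\partial\dot x^n\rangle$. $\varepsilon\colon(p'\circ p^{10})^*TM\to V(p^{10})$ is the canonical isomorphism $\varepsilon(\partial/\partial x^i)=\partial/\partial\dot x^i$, and $H^\sigma\colon(p^{10})^*TM^0\to TM^1$ is $H^\sigma=dt\otimes X^\sigma+\omega^i\otimes X^\sigma_i$. Since $(p'\circ p^{10})^*TM\subset(p^{10})^*TM^0$, $H^\sigma\circ\varepsilon^{-1}\colon T^+(M^1)\to T^-(M^1)$ is an isomorphism with $\partial/\partial\dot x^i\mapsto X^\sigma_i$. A linear frame $(X_0,\dots,X_{2n})$ of $T_\xi M^1$ is adapted to $\sigma$ if $X_0=(X^\sigma)_\xi$, $X_{n+i}$ is $p^{10}$-vertical, and $X_i=(H^\sigma\circ\varepsilon^{-1})(X_{n+i})$ for $1\le i\le n$. The adapted frames form a $G$-structure $P^\sigma\subset F(M^1)$, where $G=\{\mathrm{diag}(1,\Lambda,\Lambda):\Lambda\in Gl(n,\mathbb{R})\}\subset Gl(2n+1,\mathbb{R})$. The adjoint bundle is the bundle associated with $P^\sigma$ by the adjoint representation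 of $G$ on its Lie algebra $\mathfrak{g}\subset\mathfrak{gl}(2n+1,\mathbb{R})$; the identification is the one induced by the inclusion $P^\sigma\subset F(M^1)$ and the usual identification of the adjoint bundle of $F(M^1)$ with $T^*(M^1)\otimes T(M^1)$. *)

(* Defs.v *)
From HB Require Import structures.
From mathcomp Require Import all_boot all_order all_algebra.
From mathcomp Require Import all_classical all_reals all_analysis.

Set Implicit Arguments.
Unset Strict Implicit.
Unset Printing Implicit Defensive.

Import Order.TTheory GRing.Theory Num.Theory.
Import numFieldNormedType.Exports.

Local Open Scope classical_set_scope.
Local Open Scope ring_scope.

(* C^k regularity of f at every point of a set U, meant for open U: in finite
   dimension, f is C^(k+1) iff it is differentiable with all its directional
   derivatives C^k. *)
Fixpoint Ck_on (R : realType) (V W : normedModType R) (k : nat) (U : set V)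
    (f : V -> W) : Prop :=
  match k with
  | 0 => {in U, continuous f}
  | k'.+1 => {in U, forall x, differentiable f x} /\
             (forall v, Ck_on k' U (fun x => 'D_v f x))
  end.

Definition smooth_on (R : realType) (V W : normedModType R) (U : set V)
  (f : V -> W) : Prop := forall k, Ck_on k U f.

(* A family of R^m-valued charts on a bare set.  The topology of X, when it is
   not given beforehand, is the one defined by chart_open. *)
Record atlas (R : realType) (X : Type) (m : nat) := Atlas {
  idx : Type;
  dom : idx -> set X;
  chart : idx -> X -> 'rV[R]_m }.
Arguments dom {R X m} A _ _ : rename.
Arguments chart {R X m} A _ _ : rename.

Section Charts.
Context {R : realType} {X : Type} {m : nat} (A : atlas R X m).

(* in_chart a f is the coordinate expression f \o (chart A a)^-1 (0 outside the
   range of chart A a). *)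
Definition in_chart (W : nmodType) (a : idx A) (f : X -> W) (y : 'rV[R]_m) : W :=
  xget 0 [set w | exists x, [/\ dom A a x, chart A a x = y & f x = w]].

Definition chart_open (W : set X) : Prop :=
  forall a, open (chart A a @` (W `&` dom A a)).

Definition smooth_fun_on (W : normedModType R) (U : set X) (f : X -> W) : Prop :=
  forall a, smooth_on (chart A a @` (U `&` dom A a)) (in_chart a f).

Definition smooth_map (Y : Type) (m' : nat) (B : atlas R Y m') (f : X -> Y) :
    Prop :=
  forall a b, let U := dom A a `&` f @^-1` dom B b in
    open (chart A a @` U) /\
    smooth_on (chart A a @` U) (in_chart a (fun x => chart B b (f x))).

End Charts.
Arguments in_chart {R X m} A {W} a f y.
Arguments chart_open {R X m} A W.
Arguments smooth_fun_on {R X m} A {W} U f.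
Arguments smooth_map {R X m} A {Y m'} B f.

Record smooth_manifold (R : realType) (M : topologicalType) (n : nat)
    (A : atlas R M n) : Prop := SmoothManifold {
  mfd_hausdorff : hausdorff_space M;
  mfd_second_countable : @second_countable M;
  mfd_cover : forall x, exists a : idx A, dom A a x;
  mfd_dom_open : forall a : idx A, open (dom A a);
  mfd_chart_inj : forall a : idx A, {in dom A a &, injective (chart A a)};
  mfd_chart_continuous : forall a : idx A, {in dom A a, continuous (chart A a)};
  mfd_chart_open : forall (a : idx A) (U : set M),
    open U -> U `<=` dom A a -> open (chart A a @` U);
  mfd_transition : forall a b : idx A,
    smooth_on (chart A a @` (dom A a `&` dom A b)) (in_chart A a (chart A b)) }.

Section Tangent.
Context {R : realType} {X : Type} {m : nat} (A : atlas R X m) (x : X).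

(* A tangent vector at x is given by its components in each chart at x, which
   transform by the differentials of the coordinate changes; the components in
   the charts not defined at x are set to 0. *)
Definition tangent_compat (c : idx A -> 'rV[R]_m) : Prop :=
  (forall a, ~ dom A a x -> c a = 0) /\
  (forall a b, dom A a x -> dom A b x ->
     c b = 'd (in_chart A a (chart A b)) (chart A a x) (c a)).

Definition tangent_pred : pred (idx A -> 'rV[R]_m) :=
  fun c => `[< tangent_compat c >].

Record tangent := Tangent {
  tcoord : idx A -> 'rV[R]_m;
  _ : tcoord \in tangent_pred }.

Lemma tangent_submod_closed : submod_closed tangent_pred.
Proof.
split=> [|k u v /asboolP[u0 uE] /asboolP[v0 vE]]; apply/asboolP; split.
- by [].
- by move=> a b _ _; rewrite linear0.
- by move=> a ax; rewrite !fctE u0// v0// scaler0 addr0.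
- by move=> a b ax bx; rewrite !fctE linearP -uE// -vE.
Qed.

HB.instance Definition _ :=
  GRing.isSubmodClosed.Build R (idx A -> 'rV[R]_m) tangent_pred
    tangent_submod_closed.
HB.instance Definition _ := [isSub for tcoord].
HB.instance Definition _ := [Choice of tangent by <:].
HB.instance Definition _ := [SubChoice_isSubLmodule of tangent by <:].

Definition dcoord (a : idx A) (c : 'rV[R]_m) : tangent :=
  xget 0 [set v | tcoord v a = c].

(* The vector whose expression is F a in every chart at x (0 if none). *)
Definition common_value (F : idx A -> tangent) : tangent :=
  xget 0 [set v | forall a, dom A a x -> v = F a].

End Tangent.
Arguments tangent {R X m} A x.
Arguments dcoord {R X m} A {x} a c.
Arguments common_value {R X m} A {x} F.

(* Kernel of the differential of f at x. *)
Definition vertical (R : realType) (X Y : Type) (m m' : nat) (A : atlas R X m)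
    (B : atlas R Y m') (f : X -> Y) (x : X) : set (tangent A x) :=
  [set v | forall (a : idx A) (b : idx B), dom A a x -> dom B b (f x) ->
     'd (in_chart A a (fun y => chart B b (f y))) (chart A a x) (tcoord v a) = 0].
Arguments vertical {R X Y m m'} A B f x.

Section EndomorphismBundle.
Context {R : realType} {X : Type} {m : nat} (A : atlas R X m).

(* Smoothness over U of a section of T^*X (x) T X, seen as a field of
   endomorphisms: its components in each chart are smooth. *)
Definition smooth_endo_on (U : set X)
    (E : forall x, tangent A x -> tangent A x) : Prop :=
  (forall x, U x -> linear (E x)) /\
  (forall (a : idx A) (c : 'rV[R]_m),
     smooth_on (chart A a @` (U `&` dom A a))
       (in_chart A a (fun x => tcoord (E x (dcoord A a c)) a))).

Definition endo_subbundle (S : forall x, set (tangent A x -> tangent A x)) :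
    Prop :=
  exists r : nat, forall x0, exists U : set X,
    [/\ chart_open A U, U x0 &
     exists e : 'I_r -> forall x, tangent A x -> tangent A x,
       (forall k, smooth_endo_on U (e k)) /\
       (forall x, U x -> set_bij [set: 'rV[R]_r] (S x)
          (fun (c : 'rV[R]_r) v => \sum_k c 0 k *: e k x v))].

End EndomorphismBundle.

Section Frames.
Context {R : realType} {N : nat} {T : lmodType R}.

Definition fcomb (u : 'I_N -> T) (c : 'cV[R]_N) : T := \sum_k c k 0 *: u k.

Definition linear_frame (u : 'I_N -> T) : Prop := bijective (fcomb u).

Definition frame_act (u : 'I_N -> T) (g : 'M[R]_N) : 'I_N -> T :=
  fun l => \sum_k g k l *: u k.

(* The endomorphism u \o B \o u^-1, where u is seen as an isomorphism from R^N
   to T.  On classes [u, B] this is the usual identification of the adjoint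
   bundle of the full frame bundle with the bundle of endomorphisms. *)
Definition frame_endo (u : 'I_N -> T) (B : 'M[R]_N) (v : T) : T :=
  fcomb u (B *m xget 0 [set c | fcomb u c = v]).

End Frames.

(* Lie algebra of a matrix Lie group: velocities at the identity of the smooth
   curves in the group. *)
Definition lie_algebra (R : realType) (N : nat) (G : set 'M[R]_N) :
    set 'M[R]_N :=
  [set B | exists (U : set R) (c : R -> 'M[R]_N),
     [/\ open U /\ U 0, smooth_on U c, forall t, U t -> G (c t),
         c 0 = 1%:M & derive1 c 0 = B]].

Definition Gdiag (R : realType) (n : nat) : set 'M[R]_(1 + (n + n)) :=
  [set g | exists2 L : 'M[R]_n, L \in unitmx &
     g = block_mx 1%:M 0 0 (block_mx L 0 0 L)].

Section Jets.
Context {R : realType} {M : topologicalType} {n : nat} (A : atlas R M n).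

Definition smooth_curve (g : R -> M) : Prop :=
  continuous g /\
  forall a : idx A, smooth_on (g @^-1` dom A a) (fun s => chart A a (g s)).

Definition same_jet (r : nat) (t : R) (g h : R -> M) : Prop :=
  g t = h t /\
  forall a : idx A, dom A a (g t) -> forall k, (k <= r)%N ->
    derive1n k (fun s => chart A a (g s)) t = derive1n k (fun s => chart A a (h s)) t.

Definition jet_class (r : nat) (t : R) (g : R -> M) : set (R -> M) :=
  [set h | smooth_curve h /\ same_jet r t g h].

(* J^r(R, M): an r-jet is a source t together with a class of smooth curves. *)
Record jet (r : nat) := Jet {
  jtime : R;
  jcls : set (R -> M);
  jetP : exists2 g, smooth_curve g & jcls = jet_class r jtime g }.

Definition jet_of (r : nat) (t : R) (g : R -> M) (sg : smooth_curve g) : jet r :=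
  @Jet r t (jet_class r t g) (ex_intro2 _ _ g sg erefl).

Definition jrep (r : nat) (j : jet r) : R -> M := sval (cid2 (jetP j)).

Lemma jrep_smooth (r : nat) (j : jet r) : smooth_curve (jrep j).
Proof. by rewrite /jrep; case: cid2. Qed.

Definition jpoint (r : nat) (j : jet r) : M := jrep j (jtime j).

(* k = 0, 1, 2 give the coordinates x, \dot x, \ddot x. *)
Definition jcoord (r k : nat) (a : idx A) (j : jet r) : 'rV[R]_n :=
  derive1n k (fun s => chart A a (jrep j s)) (jtime j).

Definition p10 (j : jet 1) : R * M := (jtime j, jpoint j).

Definition p21 (j : jet 2) : jet 1 := jet_of 1 (jtime j) (jrep_smooth j).

Definition atlas0 : atlas R (R * M) (1 + n) :=
  @Atlas R (R * M) (1 + n) (idx A) (fun a => [set q | dom A a q.2])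
    (fun a q => row_mx (q.1)%:M (chart A a q.2)).

Definition atlas1 : atlas R (jet 1) (1 + (n + n)) :=
  @Atlas R (jet 1) (1 + (n + n)) (idx A) (fun a => [set j | dom A a (jpoint j)])
    (fun a j => row_mx (jtime j)%:M (row_mx (jcoord 0 a j) (jcoord 1 a j))).

Definition atlas2 : atlas R (jet 2) (1 + (n + (n + n))) :=
  @Atlas R (jet 2) (1 + (n + (n + n))) (idx A)
    (fun a => [set j | dom A a (jpoint j)])
    (fun a j => row_mx (jtime j)%:M
       (row_mx (jcoord 0 a j) (row_mx (jcoord 1 a j) (jcoord 2 a j)))).

Definition is_sode (sigma : jet 1 -> jet 2) : Prop :=
  smooth_map atlas1 atlas2 sigma /\ (forall xi, p21 (sigma xi) = xi).

Local Notation T1 xi := (tangent atlas1 xi).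

Definition d_t (xi : jet 1) (a : idx A) : T1 xi :=
  dcoord atlas1 a (row_mx 1%:M 0).
Definition d_x (xi : jet 1) (a : idx A) (i : 'I_n) : T1 xi :=
  dcoord atlas1 a (row_mx 0 (row_mx (delta_mx 0 i) 0)).
Definition d_xdot (xi : jet 1) (a : idx A) (i : 'I_n) : T1 xi :=
  dcoord atlas1 a (row_mx 0 (row_mx 0 (delta_mx 0 i))).

Definition Tplus (xi : jet 1) : set (T1 xi) :=
  vertical atlas1 atlas0 p10 xi.
Arguments Tplus : clear implicits.

Definition eps (xi : jet 1) (w : tangent A (p10 xi).2) : T1 xi :=
  common_value atlas1 (fun a => \sum_i (tcoord w a) 0 i *: d_xdot xi a i).

Definition eps_inv (xi : jet 1) (v : T1 xi) : tangent A (p10 xi).2 :=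
  xget 0 [set w | eps w = v].

(* The inclusion of (p' \o p10)^*TM into p10^*TM^0. *)
Definition space_incl (q : R * M) (w : tangent A q.2) : tangent atlas0 q :=
  common_value atlas0
    (fun a => dcoord atlas0 a (row_mx 0 (tcoord w a))).

Section Sode.
Context (sigma : jet 1 -> jet 2).

Definition sodeF (a : idx A) (xi : jet 1) : 'rV[R]_n := jcoord 2 a (sigma xi).

(* dF^j / d\dot x^i *)
Definition dF_dxdot (a : idx A) (i j : 'I_n) (xi : jet 1) : R :=
  ('D_(row_mx 0 (row_mx 0 (delta_mx 0 i)) : 'rV[R]_(1 + (n + n)))
     (in_chart atlas1 a (sodeF a)) (chart atlas1 a xi)) 0 j.

Definition Xsigma (xi : jet 1) : T1 xi :=
  common_value atlas1 (fun a =>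
    d_t xi a + \sum_i (jcoord 1 a xi) 0 i *: d_x xi a i
    + \sum_i (sodeF a xi) 0 i *: d_xdot xi a i).

Definition Xsigma_i (xi : jet 1) (a : idx A) (i : 'I_n) : T1 xi :=
  d_x xi a i + 2^-1 *: \sum_j dF_dxdot a i j xi *: d_xdot xi a j.

Definition Tzero (xi : jet 1) : set (T1 xi) :=
  [set v | exists k : R, v = k *: Xsigma xi].
Arguments Tzero : clear implicits.

Definition Tminus (xi : jet 1) : set (T1 xi) :=
  [set v | forall a : idx A, dom A a (jpoint xi) ->
     exists c : 'rV[R]_n, v = \sum_i c 0 i *: Xsigma_i xi a i].
Arguments Tminus : clear implicits.

Definition dt_form (xi : jet 1) (a : idx A) (w : tangent atlas0 (p10 xi)) : R :=
  (tcoord w a) 0 (lshift n 0).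
Definition dx_form (xi : jet 1) (a : idx A) (w : tangent atlas0 (p10 xi))
  (i : 'I_n) : R := (tcoord w a) 0 (rshift 1 i).
Definition omega (xi : jet 1) (a : idx A) (w : tangent atlas0 (p10 xi))
  (i : 'I_n) : R := dx_form a w i - (jcoord 1 a xi) 0 i * dt_form a w.

Definition Hsigma (xi : jet 1) (w : tangent atlas0 (p10 xi)) : T1 xi :=
  common_value atlas1 (fun a =>
    dt_form a w *: Xsigma xi + \sum_i omega a w i *: Xsigma_i xi a i).

(* H^sigma \o eps^-1 *)
Definition Heps (xi : jet 1) (v : T1 xi) : T1 xi :=
  Hsigma (space_incl (eps_inv v)).

Local Notation frame xi := ('I_(1 + (n + n)) -> T1 xi).

Definition adapted (xi : jet 1) : set (frame xi) :=
  [set X | [/\ linear_frame X,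
     X (lshift (n + n) 0) = Xsigma xi,
     forall i : 'I_n, Tplus xi (X (rshift 1 (rshift n i))) &
     forall i : 'I_n,
       X (rshift 1 (lshift n i)) = Heps (X (rshift 1 (rshift n i)))]].

Local Notation G := (@Gdiag R n).
Local Notation Mat := 'M[R]_(1 + (n + n)).

(* Class of (u, B) under (u, B) ~ (u g, Ad(g^-1) B), g in G. *)
Definition adj_class (xi : jet 1) (u : frame xi) (B : Mat) :
    set (frame xi * Mat) :=
  [set p | exists2 g, G g & p = (frame_act u g, invmx g *m B *m g)].

Record adj_fiber (xi : jet 1) := AdjFiber {
  adj_cls : set (frame xi * Mat);
  adj_fiberP : exists p : frame xi * Mat,
    [/\ adapted p.1, lie_algebra G p.2 & adj_cls = adj_class p.1 p.2] }.

Definition adj_mk (xi : jet 1) (u : frame xi) (B : Mat) (hu : adapted u)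
    (hB : lie_algebra G B) : adj_fiber xi :=
  @AdjFiber xi (adj_class u B)
    (ex_intro _ (u, B) (And3 hu hB erefl)).

Definition adj_endo (xi : jet 1) (c : adj_fiber xi) : T1 xi -> T1 xi :=
  let p := sval (cid (adj_fiberP c)) in frame_endo p.1 p.2.

(* Smooth sections of P^sigma x_G g: locally [u, B] with u a smooth section of
   P^sigma and B a smooth g-valued function. *)
Definition smooth_adj_on (U : set (jet 1)) (s : forall xi, adj_fiber xi) : Prop :=
  forall xi0, U xi0 -> exists V : set (jet 1),
    [/\ chart_open atlas1 V, V xi0, V `<=` U &
     exists (u : forall xi, frame xi) (B : jet 1 -> Mat),
     [/\ forall k (a : idx A), smooth_on (chart atlas1 a @`
             (V `&` dom atlas1 a))
           (in_chart atlas1 a (fun xi => tcoord (u xi k) a)),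
         smooth_fun_on atlas1 V B &
         forall xi, V xi ->
           [/\ adapted (u xi), lie_algebra G (B xi) &
               adj_cls (s xi) = adj_class (u xi) (B xi)]]].

Definition adP (xi : jet 1) : set (T1 xi -> T1 xi) :=
  [set E | [/\ linear E,
     E @` Tzero xi = [set 0],
     E @` Tminus xi `<=` Tminus xi,
     E @` Tplus xi `<=` Tplus xi &
     forall v, Tplus xi v -> E (Heps v) = Heps (E v)]].

End Sode.
End Jets.

Arguments Tplus {R M n} A xi _.
Arguments adP {R M n A} sigma xi _.
Arguments adj_endo {R M n A} sigma {xi} c _.
Arguments endo_subbundle {R X m} A S.
Arguments smooth_endo_on {R X m} A U E.
Arguments smooth_adj_on {R M n A} sigma U s.

(* Main.v *)
Require Import Defs.
From HB Require Import structures.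
From mathcomp Require Import all_boot all_order all_algebra.
From mathcomp Require Import all_classical all_reals all_analysis.
From mathcomp Require Import ring.
Set Implicit Arguments.
Unset Strict Implicit.
Unset Printing Implicit Defensive.
Import Order.TTheory GRing.Theory Num.Theory.
Import numFieldNormedType.Exports.
Local Open Scope classical_set_scope.
Local Open Scope ring_scope.

(** Everything is governed by one frame per chart.  Over the domain of a chart
   [a] of [M], the fields [X^sigma], [X^sigma_i] and [d/d xdot^i] form a smooth
   frame [sode_frame sigma a] of the tangent bundle of the jet manifold; it is
   adapted to the decomposition into the three summands, and
   [H^sigma o eps^-1] carries its last [n] vectors to the middle ones
   ([sode_splitting_frame]).  Relative to such a frame two facts are plain
   linear algebra: an endomorphism satisfies the four conditions defining
   [ad P^sigma] iff its matrix is [diag (0, L, L)] ([split_endo_gdiag],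
   [gdiag_split_endo]), and a frame is adapted iff it is the given one moved by
   an element [diag (1, L, L)] of the group ([adapted_Gdiag]).  The matrices
   [diag (0, L, L)] are exactly the Lie algebra of the group
   ([lie_algebra_GdiagP]), so [[u, B] |-> u o B o u^-1] is a linear bijection on
   fibres, and the images of the elementary matrices [L] are a local basis of
   [ad P^sigma].

   The geometric content is that the three summands and the map
   [H^sigma o eps^-1], which are described chart by chart, do not depend on the
   chart.  Write [phi] for a coordinate change on [M]; the induced change on
   1-jets is [(t, x, v) |-> (t, phi x, D_v phi x)].
   - [X^sigma] is the velocity of the prolongation [s |-> j^1_s g] of any curve
     [g] representing the 2-jet [sigma xi], so it is intrinsic by the chain rule
     ([prolong_trans], [tcoord_Xsigma]).
   - Reading off the last component gives the transformation law of the forces,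
     [F_b = D_v D_v phi + D_(F_a) phi] ([sodeF_trans]).  Differentiating it along
     the line [v + k w] yields
     [d F_b (D_w phi) = D_w D_v phi + D_v D_w phi + D_(d F_a w) phi].  The first
     two terms coincide by the symmetry of second derivatives
     ([mixed_derivativeC]), and the factor 1/2 in the definition of [X^sigma_i]
     then makes [X^sigma_i] transform linearly, by the Jacobian of [phi]
     ([dF_trans], [Xsum_trans]).

   For smoothness, let [P] be the matrix whose columns are the components in a
   chart of the vectors of a smooth frame.  The endomorphism with matrix [B] in
   that frame has matrix [P B P^-1] in the chart; as matrix inversion preserves
   smoothness, [B] is smooth iff the endomorphism field is
   ([smooth_frame_endo], [smooth_frame_coef]).  The frame of the chart [a] is
   smooth when read in another chart [b] because its components there involve,
   beyond [v], [F_b] and the derivatives of [F_b], only the inverse of the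
   Jacobian of the change from [b] to [a] ([sode_frame_smooth]).

   All of this needs the jets to fill the charts, i.e. every [(t, x, v)] must be
   the 1-jet of a curve defined on the whole line; [exists_curve] bends the
   straight line through [x] so that it never leaves the chart. *)

(** * Calculus of C^k maps on open sets *)

Section SmoothCalculus.
Context {R : realType}.
Implicit Types V W : normedModType R.

Lemma cvg_fsum (T : Type) (F : set_system T) {FF : Filter F} W (I : finType)
    (f : I -> T -> W) (l : I -> W) : (forall i, f i x @[x --> F] --> l i) ->
  \sum_i f i x @[x --> F] --> \sum_i l i.
Proof. by move=> fl; apply: cvg_big => // x; exact: add_continuous. Qed.

Lemma linear_mx_continuous (W : normedModType R) p q
  (L : {linear 'M[R]_(p, q) -> W}) : continuous L.
Proof.
move=> x.
have LE : L = (fun y : 'M[R]_(p, q) => \sum_i \sum_j y i j *: L (delta_mx i j)) :> (_ -> _).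
  apply/funext => y; rewrite [in LHS](matrix_sum_delta y) linear_sum.
  by apply: eq_bigr => i _; rewrite linear_sum; apply: eq_bigr => j _; rewrite linearZ.
rewrite LE /continuous_at; apply: (@cvg_fsum _ (nbhs x)) => i.
apply: (@cvg_fsum _ (nbhs x)) => j.
apply: (@continuousZr_tmp _ _ _ (fun y : 'M[R]_(p, q) => y i j) _ x).
exact: coord_continuous.
Qed.

Lemma linear_mx_differentiable (W : normedModType R) p q
  (L : {linear 'M[R]_(p, q) -> W}) x : differentiable L x.
Proof. exact/linear_differentiable/linear_mx_continuous. Qed.

Lemma near_eq_differentiable V W (f g : V -> W) x :
  (\near x, f x = g x) -> differentiable f x -> differentiable g x.
Proof.
move=> fg df; have fgx := nbhs_singleton fg.
apply/diff_locallyP.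
have D : g \o shift x = cst (g x) + 'd f x +o_ 0 id.
  apply/eqaddoP => e e0.
  have /diff_locallyP[_ /eqaddoP/(_ e e0)] := df.
  have : \forall h \near 0, f (h + x) = g (h + x).
    by have := fg; rewrite (near_shift 0 x) /=; apply: filterS => h; rewrite /= subr0.
  by apply: filterS2 => h /=; rewrite !fctE /= => -> ; rewrite fgx.
have dfc := diff_continuous df.
by rewrite (diff_unique dfc D).
Qed.

Lemma differentiable_mxP V p q (f : V -> 'M[R]_(p, q)) x :
  differentiable f x <-> forall i j, differentiable (fun y => f y i j) x.
Proof.
split=> [df i j|df].
  exact: (differentiable_comp df (@differentiable_coord R p q (f x) i j)).
have -> : f = \sum_i \sum_j (fun y => f y i j *: delta_mx i j).
  apply/funext => y; rewrite fct_sumE [LHS]matrix_sum_delta.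
  by apply: eq_bigr => i _; rewrite fct_sumE.
apply: differentiable_sum => i; apply: differentiable_sum => j.
exact: differentiableZl.
Qed.

Lemma Ck_on_differentiable V W k U (f : V -> W) x :
  Ck_on k.+1 U f -> U x -> differentiable f x.
Proof. by move=> [df _] Ux; apply: df; rewrite inE. Qed.

Lemma Ck_onW V W k U (f : V -> W) : Ck_on k.+1 U f -> Ck_on k U f.
Proof.
elim: k f => [|k IH] f; first by move=> -[df _] x Ux; exact/differentiable_continuous/df.
by move=> -[df Df]; split=> // v; apply/IH/Df.
Qed.

Lemma Ck_onS V W k (U U' : set V) (f : V -> W) :
  U' `<=` U -> Ck_on k U f -> Ck_on k U' f.
Proof.
move=> UU'; elim: k f => [|k IH] f.
  by move=> cf x; rewrite inE => /UU' Ux; apply: cf; rewrite inE.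
move=> -[df Df]; split=> [x|v]; last exact/IH/Df.
by rewrite inE => /UU' Ux; apply: df; rewrite inE.
Qed.

Lemma open_near_eq V W (U : set V) (f g : V -> W) x :
  open U -> {in U, f =1 g} -> U x -> \near x, f x = g x.
Proof.
move=> Uo fg Ux; apply: (filterS _ (open_nbhs_nbhs (conj Uo Ux))) => y Uy.
by apply: fg; rewrite inE.
Qed.

Lemma Ck_on_eq V W k (U : set V) (f g : V -> W) : open U -> {in U, f =1 g} ->
  Ck_on k U f -> Ck_on k U g.
Proof.
move=> Uo; elim: k f g => [|k IH] f g fg.
  move=> cf x Ux; have fgx := open_near_eq Uo fg (set_mem Ux).
  rewrite /continuous_at -(fg _ Ux).
  exact: cvg_trans (near_eq_cvg fgx) (cf x Ux).
move=> -[df Df]; split=> [x Ux|v].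
  exact: near_eq_differentiable (open_near_eq Uo fg (set_mem Ux)) (df x Ux).
apply: IH (Df v) => x Ux; exact: near_eq_derive (open_near_eq Uo fg (set_mem Ux)).
Qed.

(** C^k regularity on a set is a condition at each of its points, so it may be
   checked on any family of sets covering it. *)
Lemma Ck_on_local V W k (U : set V) (f : V -> W) :
  (forall x, U x -> exists2 U' : set V, U' x & Ck_on k U' f) -> Ck_on k U f.
Proof.
elim: k f => [|k IH] f H.
  by move=> x; rewrite inE => /H[U' U'x]; apply; rewrite inE.
split=> [x|v]; first by rewrite inE => /H[U' U'x [df _]]; apply: df; rewrite inE.
by apply: IH => x /H[U' U'x [_ Df]]; exists U' => //; exact: Df.
Qed.

Lemma Ck_on_cst V W k (U : set V) (c : W) : Ck_on k U (cst c : V -> W).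
Proof.
elim: k c => [|k IH] c; first by move=> x _; exact: cst_continuous.
split=> [x _|v]; first exact: differentiable_cst.
rewrite (_ : (fun x => _) = cst 0) //.
by apply/funext => x; exact: derive_cst.
Qed.

Lemma Ck_onD V W k (U : set V) (f g : V -> W) : open U ->
  Ck_on k U f -> Ck_on k U g -> Ck_on k U (fun x => f x + g x).
Proof.
move=> Uo; elim: k f g => [|k IH] f g.
  by move=> cf cg x Ux; apply: continuousD; [exact: cf|exact: cg].
move=> -[df Df] [dg Dg]; split=> [x Ux|v].
  by apply: differentiableD; [exact: df|exact: dg].
apply: Ck_on_eq (IH _ _ (Df v) (Dg v)) => // x Ux.
by rewrite [RHS]deriveD //; apply/diff_derivable; [exact: df|exact: dg].
Qed.

Lemma Ck_onL V W W' k (U : set V) (f : V -> W) (L : {linear W -> W'}) :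
  continuous L -> open U -> Ck_on k U f -> Ck_on k U (fun x => L (f x)).
Proof.
move=> Lc Uo; elim: k f => [|k IH] f.
  move=> cf x Ux; exact: continuous_comp (cf x Ux) (Lc _).
move=> -[df Df]; have dL x := linear_differentiable x Lc.
split=> [x Ux|v]; first exact: differentiable_comp (df x Ux) (dL _).
apply: Ck_on_eq (IH _ (Df v)) => // x Ux.
have dfx := df x Ux.
rewrite [RHS](deriveE _ (differentiable_comp dfx (dL _))) (diff_comp dfx) //=.
by rewrite (diff_lin _ Lc) (deriveE _ dfx).
Qed.

Lemma Ck_onM V k (U : set V) (f g : V -> R) : open U ->
  Ck_on k U f -> Ck_on k U g -> Ck_on k U (fun x => f x * g x).
Proof.
move=> Uo; elim: k f g => [|k IH] f g.
  by move=> cf cg x Ux; apply: continuousM; [exact: cf|exact: cg].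
move=> Cf Cg; have [df Df] := Cf; have [dg Dg] := Cg; split=> [x Ux|v].
  by apply: differentiableM; [exact: df|exact: dg].
have := Ck_onD Uo (IH _ _ (Ck_onW Cf) (Dg v)) (IH _ _ (Ck_onW Cg) (Df v)).
apply: Ck_on_eq => // x Ux.
by rewrite [RHS]deriveM //; apply/diff_derivable; [exact: df|exact: dg].
Qed.

Lemma Ck_onV V k (U : set V) (f : V -> R) : open U ->
  {in U, forall x, f x != 0} -> Ck_on k U f -> Ck_on k U (fun x => (f x)^-1).
Proof.
move=> Uo f0; elim: k => [|k IH].
  by move=> cf x Ux; apply: continuousV; [exact: f0|exact: cf].
move=> Cf; have [df Df] := Cf; split=> [x Ux|v].
  by apply: differentiableV; [exact: df|exact: f0].
have If := IH (Ck_onW Cf).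
have := Ck_onM Uo (Ck_on_cst k U (-1 : R)) (Ck_onM Uo (Ck_onM Uo If If) (Df v)).
apply: Ck_on_eq => // x Ux.
rewrite deriveV //; [|exact: f0|exact/diff_derivable/df].
by rewrite /= mulN1r scaleNr; congr (- (_ * _)); rewrite expr2 invfM.
Qed.

(** Matrix-valued maps are handled through their real entries; products,
   determinants and inverses of matrices of functions all come from this. *)
Lemma Ck_on_mxP V k (U : set V) p q (f : V -> 'M[R]_(p, q)) : open U ->
  Ck_on k U f <-> forall i j, Ck_on k U (fun x => f x i j).
Proof.
move=> Uo; elim: k f => [|k IH] f.
  split=> [cf i j x Ux|cf x Ux].
    exact: (continuous_comp (cf x Ux) (@coord_continuous R p q i j _)).
  rewrite /continuous_at.
  have fE : f = (fun y => \sum_i \sum_j f y i j *: delta_mx i j).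
    by apply/funext => y; exact: matrix_sum_delta.
  rewrite [X in X @ _]fE [X in _ --> X](congr1 (fun F => F x) fE).
  apply: (@cvg_fsum _ (nbhs x)) => i; apply: (@cvg_fsum _ (nbhs x)) => j.
  by apply: (@continuousZr_tmp _ _ _ (fun y => f y i j) _ x); exact: cf.
split=> [[df Df] i j|Df].
  split=> [x Ux|v]; first exact/(differentiable_mxP f x).1/df.
  have /IH/(_ i j) := Df v; apply: Ck_on_eq => // x Ux.
  by rewrite derive_mx ?mxE//; exact/diff_derivable/df.
have df : {in U, forall x, differentiable f x}.
  by move=> x Ux; apply/differentiable_mxP => i j; exact: (Df i j).1.
split=> // v; apply/IH => i j.
have := (Df i j).2 v; apply: Ck_on_eq => // x Ux.
by rewrite derive_mx ?mxE//; exact/diff_derivable/df.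
Qed.

Section OnOpen.
Context {V : normedModType R} {U : set V}.
Hypothesis Uo : open U.

Lemma smooth_on_eq W (f g : V -> W) :
  {in U, f =1 g} -> smooth_on U f -> smooth_on U g.
Proof. by move=> fg sf k; apply: Ck_on_eq (sf k). Qed.

Lemma smooth_onD W (f g : V -> W) :
  smooth_on U f -> smooth_on U g -> smooth_on U (fun x => f x + g x).
Proof. by move=> sf sg k; apply: Ck_onD. Qed.

Lemma smooth_onL W W' (f : V -> W) (L : {linear W -> W'}) :
  continuous L -> smooth_on U f -> smooth_on U (fun x => L (f x)).
Proof. by move=> cL sf k; apply: Ck_onL. Qed.

Lemma smooth_onM (f g : V -> R) :
  smooth_on U f -> smooth_on U g -> smooth_on U (fun x => f x * g x).
Proof. by move=> sf sg k; apply: Ck_onM. Qed.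

Lemma smooth_onV (f : V -> R) :
  {in U, forall x, f x != 0} -> smooth_on U f -> smooth_on U (fun x => (f x)^-1).
Proof. by move=> f0 sf k; apply: Ck_onV. Qed.

Lemma smooth_on_cst W (c : W) : smooth_on U (fun=> c).
Proof. by move=> k; exact: Ck_on_cst. Qed.

Lemma smooth_on_mxP p q (f : V -> 'M[R]_(p, q)) :
  smooth_on U f <-> forall i j, smooth_on U (fun x => f x i j).
Proof.
split=> [sf i j k|sf k]; first exact: (Ck_on_mxP k f Uo).1 (sf k) i j.
by apply/(Ck_on_mxP k f Uo) => i j; exact: sf.
Qed.

Lemma smooth_on_sum W (I : finType) (P : pred I) (f : I -> V -> W) :
  (forall i, smooth_on U (f i)) -> smooth_on U (fun x => \sum_(i | P i) f i x).
Proof.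
move=> sf; rewrite -[X in smooth_on _ X](@fct_sumE _ _ _ _ P f).
by elim/big_ind: _ => //; [exact: smooth_on_cst|move=> *; exact: smooth_onD].
Qed.

Lemma smooth_on_prod (I : finType) (P : pred I) (f : I -> V -> R) :
  (forall i, smooth_on U (f i)) -> smooth_on U (fun x => \prod_(i | P i) f i x).
Proof.
move=> sf; rewrite -[X in smooth_on _ X](@fct_prodE _ _ _ _ P f).
by elim/big_ind: _ => //; [exact: smooth_on_cst|move=> *; exact: smooth_onM].
Qed.

Lemma smooth_onZ p q (k : V -> R) (f : V -> 'M[R]_(p, q)) :
  smooth_on U k -> smooth_on U f -> smooth_on U (fun x => k x *: f x).
Proof.
move=> sk /smooth_on_mxP sf; apply/smooth_on_mxP => i j.
by under [X in smooth_on _ X]funext do rewrite mxE; exact: smooth_onM.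
Qed.

Lemma smooth_on_mulmx p q r (f : V -> 'M[R]_(p, q)) (g : V -> 'M[R]_(q, r)) :
  smooth_on U f -> smooth_on U g -> smooth_on U (fun x => f x *m g x).
Proof.
move=> /smooth_on_mxP sf /smooth_on_mxP sg; apply/smooth_on_mxP => i j.
under [X in smooth_on _ X]funext do rewrite mxE.
by apply: smooth_on_sum => k; exact: smooth_onM.
Qed.

Lemma smooth_on_det p (f : V -> 'M[R]_p) :
  smooth_on U f -> smooth_on U (fun x => \det (f x)).
Proof.
move=> /smooth_on_mxP sf; apply: smooth_on_sum => s.
by apply: smooth_onM; [exact: smooth_on_cst|exact: smooth_on_prod].
Qed.

Lemma smooth_on_invmx p (f : V -> 'M[R]_p) : {in U, forall x, f x \in unitmx} ->
  smooth_on U f -> smooth_on U (fun x => invmx (f x)).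
Proof.
move=> fu sf; have /smooth_on_mxP sf' := sf.
have : smooth_on U (fun x => (\det (f x))^-1 *: \adj (f x)).
  apply: smooth_onZ.
    apply: smooth_onV (smooth_on_det sf) => x Ux.
    by rewrite -unitfE -unitmxE fu.
  apply/smooth_on_mxP => i j.
  under [X in smooth_on _ X]funext do rewrite mxE.
  apply: smooth_onM; first exact: smooth_on_cst.
  apply: smooth_on_det; apply/smooth_on_mxP => k l.
  by under [X in smooth_on _ X]funext do rewrite !mxE; exact: sf'.
by apply: smooth_on_eq => x Ux; rewrite /invmx fu.
Qed.

Lemma smooth_on_derive W (f : V -> W) v : smooth_on U f -> smooth_on U ('D_v f).
Proof. by move=> sf k; exact: (sf k.+1).2. Qed.

End OnOpen.

Lemma smooth_on_differentiable V W (U : set V) (f : V -> W) x :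
  smooth_on U f -> U x -> differentiable f x.
Proof. by move=> /(_ 1%N)/Ck_on_differentiable; apply. Qed.

Lemma smooth_onS V W (U U' : set V) (f : V -> W) :
  U' `<=` U -> smooth_on U f -> smooth_on U' f.
Proof. by move=> UU' sf k; exact: Ck_onS (sf k). Qed.

Lemma smooth_on_local V W (U : set V) (f : V -> W) :
  (forall x, U x -> exists2 U' : set V, U' x & smooth_on U' f) -> smooth_on U f.
Proof. by move=> H k; apply: Ck_on_local => x /H[U' U'x sf]; exists U'. Qed.

Lemma derive_linear V W (L : {linear V -> W}) v x :
  continuous L -> 'D_v L x = L v.
Proof.
by move=> cL; rewrite deriveE ?diff_lin//; exact: linear_differentiable.
Qed.

(** The chain rule in the form used for coordinate changes, whose domain and
   codomain are row spaces. *)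
Lemma diff_chain V V' W (f : V -> V') (g : V' -> W) x v :
  differentiable f x -> differentiable g (f x) ->
  'd g (f x) ('d f x v) = 'D_v (g \o f) x.
Proof.
move=> df dg; rewrite (deriveE _ (differentiable_comp df dg)).
by rewrite (diff_comp df dg).
Qed.

Lemma smooth_on_linear V W (U : set V) (L : {linear V -> W}) :
  continuous L -> smooth_on U L.
Proof.
move=> cL [|k]; first by move=> x _; exact: cL.
split=> [x _|v]; first exact: linear_differentiable.
rewrite (_ : (fun x => _) = cst (L v)); first exact: Ck_on_cst.
by apply/funext => x; rewrite derive_linear.
Qed.

Lemma derive_comp_linear V V' W (f : V' -> W) (L : {linear V -> V'}) v x :
  'D_v (fun y => f (L y)) x = 'D_(L v) f (L x).
Proof.
rewrite /derive; set a := (fun h : R => _); set b := (fun h : R => _).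
suff -> : a = b by [].
apply/funext => h; rewrite /a /b /=; congr (_ *: (f _ - _)).
by rewrite linearD; congr (_ + _); exact: linearZ.
Qed.

Lemma smooth_on_comp_linear V V' W (U : set V') (f : V' -> W)
  (L : {linear V -> V'}) : continuous L ->
  smooth_on U f -> smooth_on (L @^-1` U) (fun y => f (L y)).
Proof.
move=> cL sf k; have {sf} := sf k; elim: k f => [|k IH] f.
  move=> cf x; rewrite inE => Ux.
  by apply: continuous_comp; [exact: cL|apply: cf; rewrite inE].
move=> [df Df]; split=> [x|v].
  rewrite inE => Ux; apply: differentiable_comp.
    exact: linear_differentiable.
  by apply: df; rewrite inE.
rewrite (_ : (fun x => _) = (fun y => 'D_(L v) f (L y))); first exact: (IH _ (Df (L v))).
by apply/funext => x; rewrite derive_comp_linear.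
Qed.

(** * Symmetry of second derivatives *)

(** The difference quotients of [t |-> f (x + t v)] at [s] are literally those of
   [f] at [x + s v] in the direction [v]. *)
Lemma is_derive_line V W (f : V -> W) x v (s : R) : derivable f (x + s *: v) v ->
  is_derive s (1 : R) (fun t : R => f (x + t *: v)) ('D_v f (x + s *: v)).
Proof.
have E : (fun h : R => h^-1 *: (((fun t : R => f (x + t *: v)) \o shift s) (h *: 1)
      - f (x + s *: v))) =
    (fun h => h^-1 *: ((f \o shift (x + s *: v)) (h *: v) - f (x + s *: v))).
  apply/funext => h /=.
  by rewrite [h *: 1]mulr1 scalerDl addrCA.
by move=> df; apply: DeriveDef; rewrite /derivable /derive E.
Qed.

Lemma is_derive_line0 V W (f : V -> W) x v :
  derivable f x v -> is_derive (0 : R) (1 : R) (fun t : R => f (x + t *: v)) ('D_v f x).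
Proof.
move=> df; have := @is_derive_line V W f x v 0; rewrite scale0r addr0; exact.
Qed.

(** The second difference over a parallelogram is a mixed derivative at an
   intermediate point: the mean value theorem is applied first along [v] to the
   difference of [f] between two opposite sides, then along [w] to ['D_v f]. *)
Lemma second_difference V (U : set V) (f : V -> R) x v w (s : R) : 0 < s ->
  Ck_on 2 U f ->
  (forall a b, 0 <= a <= s -> 0 <= b <= s -> U (x + a *: v + b *: w)) ->
  exists a b : R, [/\ 0 <= a <= s, 0 <= b <= s &
    f (x + s *: v + s *: w) - f (x + s *: v) - f (x + s *: w) + f x =
    'D_w ('D_v f) (x + a *: v + b *: w) * s * s].
Proof.
move=> s0 Cf xU.
have df y : U y -> differentiable f y by move=> Uy; apply: Cf.1; rewrite inE.
have ddf y : U y -> differentiable ('D_v f) y.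
  by move=> Uy; apply: (Cf.2 v).1; rewrite inE.
have ss : 0 <= s <= s by rewrite lexx ltW.
have s00 : 0 <= (0 : R) <= s by rewrite lexx ltW.
pose g (t : R) := f (x + s *: w + t *: v) - f (x + t *: v).
have gd t : 0 <= t <= s ->
    is_derive t (1 : R) g ('D_v f (x + s *: w + t *: v) - 'D_v f (x + t *: v)).
  move=> ts; apply: is_deriveB; apply: is_derive_line; apply/diff_derivable/df.
    by rewrite addrAC; exact: xU.
  by have := xU t 0 ts s00; rewrite scale0r addr0.
have [a aI gE] : exists2 a, a \in `]0, s[ & g s - g 0 =
    ('D_v f (x + s *: w + a *: v) - 'D_v f (x + a *: v)) * (s - 0).
  apply: (MVT s0) => [t|].
    by rewrite in_itv/= => /andP[t0 ts]; apply: gd; rewrite !ltW.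
  apply: derivable_within_continuous => t; rewrite in_itv/= => /gd gt.
  exact: ex_derive.
have as_ : 0 <= a <= s by move: aI; rewrite in_itv/= => /andP[a0 a1]; rewrite !ltW.
have hd t : 0 <= t <= s -> is_derive t (1 : R)
    (fun t : R => 'D_v f (x + a *: v + t *: w)) ('D_w ('D_v f) (x + a *: v + t *: w)).
  by move=> ts; apply: is_derive_line; apply/diff_derivable/ddf/xU.
have hd1 t : t \in `]0, s[ -> is_derive t (1 : R)
    (fun t : R => 'D_v f (x + a *: v + t *: w)) ('D_w ('D_v f) (x + a *: v + t *: w)).
  by rewrite in_itv/= => /andP[t0 ts]; apply: hd; rewrite !ltW.
have hd2 : {within `[0, s], continuous (fun t : R => 'D_v f (x + a *: v + t *: w))}.
  apply: derivable_within_continuous => t; rewrite in_itv/= => /hd ht.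
  exact: ex_derive.
have [b bI hE] := @MVT R (fun t : R => 'D_v f (x + a *: v + t *: w))
    (fun b => 'D_w ('D_v f) (x + a *: v + b *: w)) 0 s s0 hd1 hd2.
exists a, b; split=> //.
  by move: bI; rewrite in_itv/= => /andP[b0 b1]; rewrite !ltW.
move: gE hE; rewrite /g !subr0 !scale0r !addr0 => gE hE.
rewrite -hE (addrAC x (a *: v)) -gE (addrAC x (s *: w)); ring.
Qed.

(** The second difference is symmetric in [v] and [w], hence the two mixed
   derivatives take equal values at points arbitrarily close to [x], and they are
   continuous. *)
Lemma mixed_derivativeC_real V (U : set V) (f : V -> R) x v w : open U -> U x ->
  Ck_on 2 U f -> 'D_w ('D_v f) x = 'D_v ('D_w f) x.
Proof.
move=> Uo Ux Cf.
have c1 : {for x, continuous ('D_w ('D_v f))} by apply: ((Cf.2 v).2 w); rewrite inE.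
have c2 : {for x, continuous ('D_v ('D_w f))} by apply: ((Cf.2 w).2 v); rewrite inE.
apply/eqP; rewrite -subr_eq0 -normr_le0; apply/ler_addgt0Pr => e e0; rewrite add0r.
have e20 : 0 < e / 2 by rewrite divr_gt0.
have nU : nbhs x U by exact: open_nbhs_nbhs.
move/cvgrPdist_lt: c1 => /(_ _ e20) n1; move/cvgrPdist_lt: c2 => /(_ _ e20) n2.
have [r /= r0 rP] := (nbhs_ballP _ _).1 (filterI nU (filterI n1 n2)).
pose N := `|v| + `|w| + 1.
have N0 : 0 < N by rewrite ltr_wpDl// addr_ge0.
(* [s] is chosen so that the parallelogram with sides [s v], [s w] lies in the ball. *)
pose s := r / N / 2.
have s0 : 0 < s by rewrite !divr_gt0.
have sr : s * N < r.
  by rewrite /s mulrAC divfK ?gt_eqF// ltr_pdivrMr// ltr_pMr// ltr1n.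
have box a b : 0 <= a <= s -> 0 <= b <= s -> ball x r (x + a *: v + b *: w).
  move=> /andP[a0 as_] /andP[b0 bs]; rewrite -ball_normE /ball_/=.
  rewrite -addrA opprD addrA subrr add0r normrN.
  apply: le_lt_trans sr; apply: le_trans (ler_normD _ _) _.
  rewrite !normrZ !ger0_norm// /N !mulrDr mulr1 -[leLHS]addr0.
  by apply: lerD; [apply: lerD; exact: ler_wpM2r|exact: ltW].
have box' a b : 0 <= a <= s -> 0 <= b <= s -> ball x r (x + a *: w + b *: v).
  by move=> aP bP; rewrite addrAC; exact: box.
have [a [b [aP bP E1]]] :=
  second_difference s0 Cf (fun a b aP bP => (rP _ (box a b aP bP)).1).
have [c [d [cP dP E2]]] :=
  second_difference s0 Cf (fun a b aP bP => (rP _ (box' a b aP bP)).1).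
have E : 'D_w ('D_v f) (x + a *: v + b *: w) = 'D_v ('D_w f) (x + c *: w + d *: v).
  apply: (@mulIf _ (s * s)); first by rewrite mulf_neq0// gt_eqF.
  rewrite [LHS]mulrA [RHS]mulrA; apply: (etrans (esym E1)); apply: etrans E2.
  by rewrite (addrAC x (s *: w)); congr (_ + _); exact: addrAC.
have /= d1 := (rP _ (box _ _ aP bP)).2.1.
have /= d2 := (rP _ (box' _ _ cP dP)).2.2.
rewrite [e]splitr -(subrKA ('D_w ('D_v f) (x + a *: v + b *: w))).
apply: (le_trans (ler_normD _ _)); apply: lerD; apply: ltW; first exact: d1.
by rewrite E distrC; exact: d2.
Qed.

Lemma mixed_derivativeC V p q (U : set V) (f : V -> 'M[R]_(p, q)) x v w : open U -> U x ->
  Ck_on 2 U f -> 'D_w ('D_v f) x = 'D_v ('D_w f) x.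
Proof.
move=> Uo Ux Cf; apply/matrixP => i j.
have Cij := (Ck_on_mxP 2 f Uo).1 Cf i j.
suff D a b : ('D_a ('D_b f) x) i j = 'D_a ('D_b (fun y => f y i j)) x.
  exact: etrans (D w v) (etrans (mixed_derivativeC_real v w Uo Ux Cij) (esym (D v w))).
rewrite derive_mx ?mxE; last first.
  by apply: diff_derivable; apply: (Cf.2 b).1; rewrite inE.
apply: near_eq_derive; apply: (filterS _ (open_nbhs_nbhs (conj Uo Ux))) => y Uy.
rewrite derive_mx ?mxE//.
by apply: diff_derivable; apply: Cf.1; rewrite inE.
Qed.

Lemma smooth_on_derive_differentiable V W (U : set V) (f : V -> W) x v :
  smooth_on U f -> U x -> differentiable ('D_v f) x.
Proof. by move=> sf Ux; apply: smooth_on_differentiable (smooth_on_derive v sf) Ux. Qed.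

Lemma derive_affine_direction V W (f : V -> W) x l l' (k : R) : differentiable f x ->
  'D_(l + k *: l') f x = 'D_l f x + k *: 'D_l' f x.
Proof. by move=> df; rewrite !deriveE// linearD linearZ. Qed.

(** Linearity in the inner direction gets differentiated, so it is needed at all
   points near [x]; hence the smoothness on an open set. *)
Lemma derive2_affine_direction V W (U : set V) (f : V -> W) x r l l' (k : R) :
  open U -> U x -> smooth_on U f ->
  'D_r ('D_(l + k *: l') f) x = 'D_r ('D_l f) x + k *: 'D_r ('D_l' f) x.
Proof.
move=> Uo Ux sf.
have E : \forall y \near x, 'D_(l + k *: l') f y = ('D_l f + k *: 'D_l' f) y.
  apply: filterS (open_nbhs_nbhs (conj Uo Ux)) => y Uy.
  exact: derive_affine_direction (smooth_on_differentiable sf Uy).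
have dl := diff_derivable (v := r) (smooth_on_derive_differentiable l sf Ux).
have dl' := diff_derivable (v := r) (smooth_on_derive_differentiable l' sf Ux).
apply: etrans (near_eq_derive r E) _.
apply: etrans (deriveD dl (derivableZ dl')) _.
by rewrite (deriveZ _ dl').
Qed.

(** First derivative at 0 of the right-hand side of the transformation law of the
   forces restricted to a line in the fibre: a quadratic polynomial plus the image
   of a curve under a linear map. *)
Lemma derive_quadratic_linear W W' (c0 c1 c2 : W) (L : {linear W' -> W}) (c : R -> W') :
  continuous L -> derivable c 0 1 ->
  'D_1 (fun k : R => (c0 + k *: c1 + (k * k) *: c2) + L (c k)) 0 = c1 + L ('D_1 c 0).
Proof.
move=> cL /derivable1_diffP dc.
have did : is_derive (0 : R) (1 : R) (id : R -> R) 1 by exact: is_derive_id.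
have d1 : differentiable (fun k : R => k *: c1) 0 by exact: differentiableZl.
have dkk : differentiable (fun k : R => k * k) 0 by exact: differentiableM.
have d2 : differentiable (fun k : R => (k * k) *: c2) 0.
  exact: differentiableZl.
have dLc : differentiable (fun k => L (c k)) 0.
  exact: differentiable_comp dc (linear_differentiable _ cL).
have d01 : differentiable (fun k : R => c0 + k *: c1) 0.
  by apply: differentiableD => //; exact: differentiable_cst.
have d012 : differentiable (fun k : R => c0 + k *: c1 + (k * k) *: c2) 0.
  exact: differentiableD d01 d2.
have e1 : 'D_1 (fun k : R => k *: c1) 0 = c1.
  by rewrite (deriveE _ d1) diff_val /= scale1r.
have e2 : 'D_1 (fun k : R => (k * k) *: c2) 0 = 0.
  rewrite (deriveE _ d2) (diffZl _ dkk) -(deriveE _ dkk).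
  by rewrite deriveM// !derive_id !scale0r addr0 scale0r.
apply: etrans (deriveD (diff_derivable d012) (diff_derivable dLc)) _.
congr (_ + _).
  apply: etrans (deriveD (diff_derivable d01) (diff_derivable d2)) _.
  rewrite e2 addr0.
  have dc0 := derivable_cst c0 (0 : R) (1 : R).
  apply: etrans (@deriveD _ _ _ (cst c0) _ _ _ dc0 (diff_derivable d1)) _.
  by rewrite derive_cst add0r.
have dL := linear_differentiable (c 0) cL.
rewrite -[LHS](diff_chain (1 : R) dc dL) (diff_lin _ cL).
by rewrite (deriveE _ dc).
Qed.

End SmoothCalculus.

(** * Frames and endomorphisms *)

Section FrameAlgebra.
Context {R : realType} {N : nat} {T : lmodType R}.
Implicit Types (u : 'I_N -> T) (c : 'cV[R]_N) (B g : 'M[R]_N).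

Lemma fcomb_linear u : linear (fcomb u).
Proof.
move=> k c d; rewrite /fcomb scaler_sumr -big_split/=; apply: eq_bigr => i _.
by rewrite !mxE scalerDl scalerA.
Qed.

Lemma fcombD u c d : fcomb u (c + d) = fcomb u c + fcomb u d.
Proof. by have := fcomb_linear u 1 c d; rewrite !scale1r. Qed.

Lemma fcombZ u k c : fcomb u (k *: c) = k *: fcomb u c.
Proof.
by rewrite /fcomb scaler_sumr; apply: eq_bigr => i _; rewrite !mxE scalerA.
Qed.

Lemma fcomb_sum u (I : finType) (c : I -> 'cV[R]_N) :
  fcomb u (\sum_i c i) = \sum_i fcomb u (c i).
Proof.
rewrite /fcomb exchange_big/=; apply: eq_bigr => k _.
by rewrite summxE scaler_suml.
Qed.

Lemma fcomb_delta u k : fcomb u (delta_mx k 0) = u k.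
Proof.
rewrite /fcomb (bigD1 k)//= mxE !eqxx scale1r big1 ?addr0// => i ik.
by rewrite mxE (negbTE ik) scale0r.
Qed.

Lemma fcomb_act u g c : fcomb (frame_act u g) c = fcomb u (g *m c).
Proof.
rewrite /fcomb /frame_act; under eq_bigr do rewrite scaler_sumr.
rewrite exchange_big/=; apply: eq_bigr => k _.
by rewrite mxE scaler_suml; apply: eq_bigr => l _; rewrite scalerA mulrC.
Qed.

Lemma frame_act1 u : frame_act u 1%:M = u.
Proof. by apply/funext => k; rewrite -fcomb_delta fcomb_act mul1mx fcomb_delta. Qed.

Lemma fcomb_xgetK u c : linear_frame u -> xget 0 [set d | fcomb u d = fcomb u c] = c.
Proof. by move=> /bij_inj fi; case: xgetP => [d _ /fi//|/(_ c)] /(_ erefl). Qed.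

Lemma frame_endoE u B c : linear_frame u ->
  frame_endo u B (fcomb u c) = fcomb u (B *m c).
Proof. by move=> lu; rewrite /frame_endo fcomb_xgetK. Qed.

Lemma frame_surj u v : linear_frame u -> exists c, v = fcomb u c.
Proof. by move=> [f _ fK]; exists (f v); rewrite fK. Qed.

Lemma frame_endo_linear u B : linear_frame u -> linear (frame_endo u B).
Proof.
move=> lu k v w; have [c ->] := frame_surj v lu; have [d ->] := frame_surj w lu.
by rewrite -fcombZ -fcombD !frame_endoE// mulmxDr -scalemxAr fcombD fcombZ.
Qed.

Lemma frame_endo_inj u B C : linear_frame u ->
  frame_endo u B = frame_endo u C -> B = C.
Proof.
move=> lu BC; apply/matrixP => i j.
have /(bij_inj lu) E : fcomb u (B *m delta_mx j 0) = fcomb u (C *m delta_mx j 0).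
  by rewrite -!frame_endoE// BC.
by move: E; rewrite -!colE => /matrixP/(_ i 0); rewrite !mxE.
Qed.

Lemma eq_linear_on_frame u (E F : T -> T) : linear_frame u ->
  linear E -> linear F -> (forall k, E (u k) = F (u k)) -> E = F.
Proof.
move=> lu lE lF EF; apply/funext => v; have [c ->] := frame_surj v lu.
pose El : {linear T -> T} := HB.pack E (GRing.isLinear.Build _ _ _ _ _ lE).
pose Fl : {linear T -> T} := HB.pack F (GRing.isLinear.Build _ _ _ _ _ lF).
change (El (fcomb u c) = Fl (fcomb u c)); rewrite /fcomb !linear_sum.
by apply: eq_bigr => i _; rewrite !linearZ; congr (_ *: _); exact: EF.
Qed.

(** This is what makes the endomorphism of a class [[u, B]] independent of the
   representative. *)
Lemma frame_endo_act u B g : linear_frame u -> g \in unitmx ->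
  frame_endo (frame_act u g) (invmx g *m B *m g) = frame_endo u B.
Proof.
move=> lu gu.
have lug : linear_frame (frame_act u g).
  have [f fK Kf] := lu; exists (fun v => invmx g *m f v) => x.
    by rewrite fcomb_act fK mulKmx.
  by rewrite fcomb_act mulKVmx.
apply/funext => v; have [c ->] := frame_surj v lug.
by rewrite frame_endoE// !fcomb_act frame_endoE// !mulmxA mulmxV// mul1mx.
Qed.

End FrameAlgebra.

(** * Frames compatible with a splitting into three summands *)

Section AdaptedAlgebra.
Context {R : realType} {n : nat}.
Local Notation i0 := (lshift (n + n) 0 : 'I_(1 + (n + n))).
Local Notation im i := (rshift 1 (lshift n i) : 'I_(1 + (n + n))).
Local Notation ip i := (rshift 1 (rshift n i) : 'I_(1 + (n + n))).

(** The matrix [diag (0, L, L)], the general element of the Lie algebra. *)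
Definition gdiag (L : 'M[R]_n) : 'M[R]_(1 + (n + n)) :=
  block_mx 0 0 0 (block_mx L 0 0 L).

(** The matrix [diag (1, L, L)], an element of the group when [L] is invertible. *)
Definition Gmx (L : 'M[R]_n) : 'M[R]_(1 + (n + n)) :=
  block_mx 1%:M 0 0 (block_mx L 0 0 L).

Lemma Gdiag_unit (g : 'M[R]_(1 + (n + n))) : Gdiag g -> g \in unitmx.
Proof.
move=> [L Lu ->]; rewrite unitmxE det_ublock det1 mul1r det_ublock.
by rewrite unitrM -unitmxE Lu.
Qed.

Lemma gdiag_linear k L L' : gdiag (k *: L + L') = k *: gdiag L + gdiag L'.
Proof.
by rewrite /gdiag !(scale_block_mx, add_block_mx) !(scaler0, addr0).
Qed.

Lemma cV_split (c : 'cV[R]_(1 + (n + n))) :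
  c = col_mx (usubmx c) (col_mx (usubmx (dsubmx c)) (dsubmx (dsubmx c))).
Proof. by rewrite !vsubmxK. Qed.

Lemma gdiag_mul L (a : 'cV[R]_1) (b c : 'cV[R]_n) :
  gdiag L *m col_mx a (col_mx b c) = col_mx 0 (col_mx (L *m b) (L *m c)).
Proof.
by rewrite /gdiag !mul_block_col !mul0mx !(add0r, addr0).
Qed.

Lemma gdiag_mul0 L (a : 'cV[R]_1) : gdiag L *m col_mx a 0 = 0.
Proof. by rewrite /gdiag mul_block_col !mulmx0 !mul0mx !addr0 col_mx0. Qed.

Lemma Gmx_mul L (a : 'cV[R]_1) (b c : 'cV[R]_n) :
  Gmx L *m col_mx a (col_mx b c) = col_mx a (col_mx (L *m b) (L *m c)).
Proof.
by rewrite /Gmx !mul_block_col !mul0mx mul1mx !(add0r, addr0).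
Qed.

Lemma Gmx_mul0 L (a : 'cV[R]_1) : Gmx L *m col_mx a 0 = col_mx a 0.
Proof.
by rewrite /Gmx mul_block_col !mulmx0 !mul0mx mul1mx !addr0.
Qed.

Lemma injective_unitmx p (L : 'M[R]_p) :
  (forall c : 'cV[R]_p, L *m c = 0 -> c = 0) -> L \in unitmx.
Proof.
move=> Li; rewrite -unitmx_tr -row_free_unit -kermx_eq0; apply/eqP/row_matrixP => i.
rewrite row0; apply/trmx_inj; rewrite trmx0; apply: Li.
have := congr1 trmx (congr1 (row i) (mulmx_ker L^T)).
by rewrite row_mul trmx_mul trmxK row0 trmx0.
Qed.

Context {T : lmodType R}.
Implicit Types (u : 'I_(1 + (n + n)) -> T).

Lemma fcomb_split u (a : 'cV[R]_1) (b c : 'cV[R]_n) :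
  fcomb u (col_mx a (col_mx b c)) =
  a 0 0 *: u i0 + \sum_i b i 0 *: u (im i) + \sum_i c i 0 *: u (ip i).
Proof.
rewrite /fcomb big_split_ord big_ord1 big_split_ord/= addrA.
rewrite col_mxEu; congr (_ + _ + _); apply: eq_bigr => i _.
  by rewrite col_mxEd col_mxEu.
by rewrite !col_mxEd.
Qed.

Lemma fcomb0 u : fcomb u 0 = 0.
Proof. by rewrite -[0](scale0r 0) fcombZ scale0r. Qed.

(** The linear data at one point of the jet manifold: [u] consists of a vector of
   [Tz], then [n] vectors of [Tm], then [n] vectors of [Tp], and [H] sends the last
   ones to the middle ones in order.  [H] is constrained on [Tp] only, because that
   is where [H^sigma o eps^-1] is defined. *)
Record splitting_frame u (Tz Tm Tp : set T) (H : T -> T) : Prop := SplittingFrame {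
  sf_frame : linear_frame u;
  sf_zero : forall v, Tz v <-> exists k : R, v = k *: u i0;
  sf_minus : forall v, Tm v <-> exists b : 'cV[R]_n, v = \sum_i b i 0 *: u (im i);
  sf_plus : forall v, Tp v <-> exists c : 'cV[R]_n, v = \sum_i c i 0 *: u (ip i);
  sf_swap : forall c : 'cV[R]_n,
    H (\sum_i c i 0 *: u (ip i)) = \sum_i c i 0 *: u (im i) }.

Section WithSplitting.
Context {u : 'I_(1 + (n + n)) -> T} {Tz Tm Tp : set T} {H : T -> T}.
Hypothesis S : splitting_frame u Tz Tm Tp H.
Let lu := sf_frame S.

Lemma fcomb_plusE (c : 'cV[R]_n) :
  fcomb u (col_mx 0 (col_mx 0 c)) = \sum_i c i 0 *: u (ip i).
Proof.
rewrite fcomb_split mxE scale0r add0r big1 ?add0r// => i _.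
by rewrite mxE scale0r.
Qed.

Lemma fcomb_minusE (b : 'cV[R]_n) :
  fcomb u (col_mx 0 (col_mx b 0)) = \sum_i b i 0 *: u (im i).
Proof.
rewrite fcomb_split mxE scale0r add0r [X in _ + X]big1 ?addr0// => i _.
by rewrite mxE scale0r.
Qed.

Lemma fcomb_zeroE (a : 'cV[R]_1) : fcomb u (col_mx a 0) = a 0 0 *: u i0.
Proof.
by rewrite -[0 in LHS]col_mx0 fcomb_split !big1 ?addr0// => i _; rewrite mxE scale0r.
Qed.

Lemma swap_fcombE (c : 'cV[R]_n) :
  H (fcomb u (col_mx 0 (col_mx 0 c))) = fcomb u (col_mx 0 (col_mx c 0)).
Proof. by rewrite fcomb_plusE fcomb_minusE (sf_swap S). Qed.

(** The conditions defining the fibre of [ad P^sigma], for an abstract splitting. *)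
Definition split_endo (E : T -> T) : Prop :=
  [/\ linear E, E @` Tz = [set 0], E @` Tm `<=` Tm, E @` Tp `<=` Tp &
     forall v, Tp v -> E (H v) = H (E v)].

Lemma gdiag_split_endo L : split_endo (frame_endo u (gdiag L)).
Proof.
split; first exact: frame_endo_linear.
- apply/seteqP; split=> [_ [v /(sf_zero S)[k ->] <-]|_ ->]; last first.
    exists 0; first by apply/(sf_zero S); exists 0; rewrite scale0r.
    by rewrite -(fcomb0 u) frame_endoE// mulmx0.
  have -> : k *: u i0 = fcomb u (col_mx k%:M 0) by rewrite fcomb_zeroE mxE eqxx.
  by rewrite frame_endoE// gdiag_mul0 fcomb0.
- move=> _ [v /(sf_minus S)[b ->] <-]; apply/(sf_minus S); exists (L *m b).
  by rewrite -fcomb_minusE frame_endoE// gdiag_mul mulmx0 fcomb_minusE.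
- move=> _ [v /(sf_plus S)[b ->] <-]; apply/(sf_plus S); exists (L *m b).
  by rewrite -fcomb_plusE frame_endoE// gdiag_mul mulmx0 fcomb_plusE.
- move=> v /(sf_plus S)[c ->].
  by rewrite -fcomb_plusE swap_fcombE !frame_endoE// !gdiag_mul !mulmx0 swap_fcombE.
Qed.

(** The matrix [L] is that of [E] on [Tp]; commuting with [H] forces the same matrix
   on [Tm]. *)
Lemma split_endo_gdiag E : split_endo E -> exists L, E = frame_endo u (gdiag L).
Proof.
move=> [lE Ez Em Ep EH].
have comp i : exists c : 'cV[R]_n, E (u (ip i)) = fcomb u (col_mx 0 (col_mx 0 c)).
  have /Ep/(sf_plus S)[c cE] : (E @` Tp) (E (u (ip i))).
    exists (u (ip i)) => //; apply/(sf_plus S); exists (delta_mx i 0).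
    rewrite (bigD1 i)//= mxE !eqxx scale1r big1 ?addr0// => j ji.
    by rewrite mxE (negbTE ji) scale0r.
  by exists c; rewrite fcomb_plusE.
have [c cE] := choice comp.
pose L := \matrix_(k, i) c i k 0; exists L.
have Lc i : L *m delta_mx i 0 = c i.
  by rewrite -colE; apply/colP => k; rewrite !mxE.
have upE i : u (ip i) = fcomb u (col_mx 0 (col_mx 0 (delta_mx i 0))).
  by rewrite -[LHS]fcomb_delta; congr fcomb; rewrite -!delta_mx_dshift.
have umE i : u (im i) = fcomb u (col_mx 0 (col_mx (delta_mx i 0) 0)).
  by rewrite -[LHS]fcomb_delta; congr fcomb; rewrite -delta_mx_ushift -delta_mx_dshift.
apply: (eq_linear_on_frame lu lE (frame_endo_linear _ lu)) => k.
case: (split_ordP k) => [j ->|j ->]; last case: (split_ordP j) => [i ->|i ->].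
- rewrite (ord1 j) -[u _]scale1r.
  have [_ Es] : E @` Tz = [set 0] /\ True by [].
  have -> : E (1 *: u i0) = 0.
    have : [set 0] (E (1 *: u i0)).
      by rewrite -Ez; exists (1 *: u i0) => //; apply/(sf_zero S); exists 1.
    by [].
  have -> : 1 *: u i0 = fcomb u (col_mx 1%:M 0) by rewrite fcomb_zeroE mxE eqxx.
  by rewrite frame_endoE// gdiag_mul0 fcomb0.
- rewrite umE frame_endoE// gdiag_mul mulmx0 Lc -swap_fcombE -upE EH; last first.
    by apply/(sf_plus S); exists (delta_mx i 0); rewrite -fcomb_plusE upE.
  by rewrite cE swap_fcombE.
- by rewrite cE upE frame_endoE// gdiag_mul mulmx0 Lc.
Qed.

(** The last vectors of [X] are combinations of the last vectors of [u] with some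
   matrix [L]; applying [H] gives the middle ones, with the same [L]. *)
Lemma adapted_Gdiag X : linear_frame X -> X i0 = u i0 ->
  (forall i, Tp (X (ip i))) -> (forall i, X (im i) = H (X (ip i))) ->
  exists2 g, Gdiag g & X = frame_act u g.
Proof.
move=> lX X0 Xp Xm.
have comp i : exists c : 'cV[R]_n, X (ip i) = fcomb u (col_mx 0 (col_mx 0 c)).
  by have /(sf_plus S)[c cE] := Xp i; exists c; rewrite fcomb_plusE.
have [c cE] := choice comp.
pose L := \matrix_(k, i) c i k 0.
have Lc i : L *m delta_mx i 0 = c i.
  by rewrite -colE; apply/colP => k; rewrite !mxE.
pose g := Gmx L.
have XE : X = frame_act u g.
  apply/funext => k; rewrite -[RHS]fcomb_delta fcomb_act /g.
  case: (split_ordP k) => [j ->|j ->]; last case: (split_ordP j) => [i ->|i ->].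
  - rewrite (ord1 j) delta_mx_ushift Gmx_mul0.
    by rewrite fcomb_zeroE mxE !eqxx scale1r.
  - rewrite delta_mx_dshift delta_mx_ushift Gmx_mul mulmx0 Lc Xm cE.
    by rewrite swap_fcombE.
  - by rewrite !delta_mx_dshift Gmx_mul mulmx0 Lc cE.
exists g => //; exists L => //; apply: injective_unitmx => d Ld.
have : fcomb X (col_mx 0 (col_mx 0 d)) = fcomb X 0.
  by rewrite XE !fcomb_act Gmx_mul mulmx0 Ld !col_mx0 mulmx0.
by move/(bij_inj lX)/eqP; rewrite !col_mx_eq0 => /and3P[_ _ /eqP].
Qed.

End WithSplitting.
End AdaptedAlgebra.

(** * The Lie algebra of the structure group *)

Section LieAlgebra.
Context {R : realType} {n : nat}.

(** The entries outside the two diagonal blocks are constant along a curve in the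
   group, and the two blocks coincide; conversely [diag (0, L, L)] is the velocity
   of [1 + t diag (0, L, L)], which stays in the group as long as
   [det (1 + t L)] does not vanish. *)
Lemma lie_algebra_GdiagP (B : 'M[R]_(1 + (n + n))) :
  lie_algebra (@Gdiag R n) B <-> exists L, B = gdiag L.
Proof.
split=> [[U [c [[Uo U0] sc cG c0 dc]]]|[L ->]].
  have cd : derivable c 0 1.
    apply: diff_derivable; exact: smooth_on_differentiable sc U0.
  have DB i j : B i j = 'D_1 (fun t => c t i j) 0 by rewrite -dc derive1E derive_mx ?mxE.
  pose r : 'M[R]_(1 + (n + n)) -> 'M[R]_n := fun g => ulsubmx (drsubmx g).
  exists (r B).
  have D0 (f : R -> R) k : (forall t, U t -> f t = k) -> 'D_1 f 0 = 0.
    move=> fk; apply: (@eq_trans _ _ ('D_1 (cst k : R -> R) 0)); last exact: derive_cst.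
    apply: near_eq_derive.
    by apply: (filterS _ (open_nbhs_nbhs (conj Uo U0))) => t /fk.
  apply/matrixP => i j; rewrite DB.
  case: (split_ordP i) => [i' ->|i' ->].
    rewrite (D0 _ ((1%:M : 'M[R]_(1 + (n + n))) (lshift _ i') j)).
      rewrite /gdiag; case: (split_ordP j) => [j' ->|j' ->].
        by rewrite block_mxEul mxE.
      by rewrite block_mxEur mxE.
    move=> t /cG[L _ ->]; rewrite [1%:M in RHS]scalar_mx_block.
    by case: (split_ordP j) => [j' ->|j' ->]; rewrite ?block_mxEul ?block_mxEur.
  case: (split_ordP j) => [j' ->|j' ->].
    rewrite /gdiag block_mxEdl mxE; apply: (D0 _ 0) => t /cG[L _ ->].
    by rewrite block_mxEdl mxE.
  rewrite /gdiag block_mxEdr.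
  case: (split_ordP i') => [i'' ->|i'' ->]; case: (split_ordP j') => [j'' ->|j'' ->].
  - by rewrite block_mxEul /r !mxE DB.
  - rewrite block_mxEur mxE; apply: (D0 _ 0) => t /cG[L _ ->].
    by rewrite block_mxEdr block_mxEur mxE.
  - rewrite block_mxEdl mxE; apply: (D0 _ 0) => t /cG[L _ ->].
    by rewrite block_mxEdr block_mxEdl mxE.
  - rewrite block_mxEdr /r !mxE DB; apply: near_eq_derive.
    apply: (filterS _ (open_nbhs_nbhs (conj Uo U0))) => t /cG[L' _ ->].
    by rewrite !block_mxEdr block_mxEul.
pose p (t : R) := 1%:M + t *: L.
pose U := [set t : R | \det (p t) != 0].
have sp V W : open V -> smooth_on V (fun t : R => (cst W t : 'M[R]_n) + t *: L).
  move=> Vo; apply: smooth_onD => //; first exact: smooth_on_cst.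
  apply: smooth_onZ => //; last exact: smooth_on_cst.
  by apply: (@smooth_on_linear _ R R V idfun) => x.
have detc : continuous (fun t => \det (p t)).
  move=> t; have := smooth_on_det openT (sp _ 1%:M openT) 0%N.
  by apply; rewrite inE.
have Uo : open U.
  have /continuousP/(_ [set x : R | x != 0]) := detc; apply.
  rewrite (_ : [set x : R | x != 0] = ~` [set 0]); last by apply/seteqP; split=> x /eqP.
  by apply: closed_openC; exact: closed_eq.
exists U, (fun t => 1%:M + t *: gdiag L); split.
- by split=> //; rewrite /U/= /p scale0r addr0 det1 oner_neq0.
- apply: smooth_onD => //; first exact: smooth_on_cst.
  apply: smooth_onZ => //; last exact: smooth_on_cst.
  by apply: (@smooth_on_linear _ R R U idfun) => x.
- move=> t Ut; exists (p t); first by rewrite unitmxE unitfE.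
  rewrite [1%:M in LHS]scalar_mx_block [1%:M in X in block_mx _ _ _ X]scalar_mx_block.
  by rewrite /gdiag !scale_block_mx !add_block_mx !scaler0 !addr0.
- by rewrite scale0r addr0.
- rewrite derive1E deriveD// ?derive_cst ?add0r; last first.
    by apply: diff_derivable; apply: differentiableZl.
  rewrite deriveE; last exact: differentiableZl.
  by rewrite diff_val /= scale1r.
Qed.

End LieAlgebra.

(** * Tangent vectors and smooth frames of an atlas *)

Section ChartedSets.
Context {R : realType} {X : Type} {m : nat} (A : atlas R X m).

(** What is needed of an atlas for a tangent vector to be determined by, and freely
   prescribed through, its components in one chart.  No topology on [X] is involved,
   so the definition applies to jet manifolds. *)
Record differentiable_atlas : Prop := DifferentiableAtlas {
  da_inj : forall a : idx A, {in dom A a &, injective (chart A a)};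
  da_nbhs : forall (a b : idx A) x, dom A a x -> dom A b x ->
    nbhs (chart A a x) (chart A a @` (dom A a `&` dom A b));
  da_diff : forall (a b : idx A) x, dom A a x -> dom A b x ->
    differentiable (in_chart A a (chart A b)) (chart A a x) }.

Lemma in_chart_injE (W : nmodType) (f : X -> W) a x :
  {in dom A a &, injective (chart A a)} -> dom A a x ->
  in_chart A a f (chart A a x) = f x.
Proof.
move=> ai ax; rewrite /in_chart; case: xgetP => [w -> [y [ay yx <-]]|/(_ (f x)) []].
  by rewrite (ai y x)// inE.
by exists x.
Qed.

Hypothesis hA : differentiable_atlas.

Lemma chart_eq a x y : dom A a x -> dom A a y -> chart A a x = chart A a y -> x = y.
Proof. by move=> ax ay; apply: (da_inj hA); rewrite inE. Qed.

Lemma in_chartE (W : nmodType) (f : X -> W) a x : dom A a x ->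
  in_chart A a f (chart A a x) = f x.
Proof. exact/in_chart_injE/(da_inj hA). Qed.

Lemma chart_openI (V W : set X) :
  chart_open A V -> chart_open A W -> chart_open A (V `&` W).
Proof.
move=> Vo Wo a.
rewrite (_ : _ @` _ = (chart A a @` (V `&` dom A a)) `&` (chart A a @` (W `&` dom A a))).
  exact: openI.
apply/seteqP; split=> [_ [x [[Vx Wx] ax] <-]|_ [[x [Vx ax] <-] [y [Wy ay]]]].
  by split; exists x.
by move=> /(chart_eq ay ax) yx; exists x => //; split=> //; split=> //; rewrite -yx.
Qed.

Lemma smooth_in_chart_eq (W : normedModType R) (V : set X) a (f g : X -> W) :
  open (chart A a @` (V `&` dom A a)) -> (forall x, V x -> dom A a x -> f x = g x) ->
  smooth_on (chart A a @` (V `&` dom A a)) (in_chart A a f) ->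
  smooth_on (chart A a @` (V `&` dom A a)) (in_chart A a g).
Proof.
move=> Vo fg; apply: smooth_on_eq => // y /set_mem[x [Vx ax] <-].
by rewrite !in_chartE// fg.
Qed.

Section SmoothMatrixInChart.
Context (V : set X) (a : idx A).
Hypothesis Vo : open (chart A a @` (V `&` dom A a)).
Local Notation smooth_in f :=
  (smooth_on (chart A a @` (V `&` dom A a)) (in_chart A a f)).

Lemma smooth_in_chart_mxP p q (f : X -> 'M[R]_(p, q)) :
  smooth_in f <-> forall i j, smooth_in (fun x => f x i j : R).
Proof.
split=> [/(smooth_on_mxP Vo) sf i j|sf].
  have := sf i j; apply: smooth_on_eq => // y /set_mem[x [Vx ax] <-].
  by rewrite !in_chartE.
apply/(smooth_on_mxP Vo) => i j.
have := sf i j; apply: smooth_on_eq => // y /set_mem[x [Vx ax] <-].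
by rewrite !in_chartE.
Qed.

Lemma smooth_in_chart_mulmx p q r (f : X -> 'M[R]_(p, q)) (g : X -> 'M[R]_(q, r)) :
  smooth_in f -> smooth_in g -> smooth_in (fun x => f x *m g x).
Proof.
move=> sf sg; have := smooth_on_mulmx Vo sf sg.
apply: smooth_on_eq => // y /set_mem[x [Vx ax] <-].
by rewrite !in_chartE.
Qed.

Lemma smooth_in_chart_invmx p (f : X -> 'M[R]_p) :
  (forall x, V x -> dom A a x -> f x \in unitmx) ->
  smooth_in f -> smooth_in (fun x => invmx (f x)).
Proof.
move=> fu sf; have : smooth_on (chart A a @` (V `&` dom A a))
    (fun y => invmx (in_chart A a f y)).
  apply: smooth_on_invmx => // y /set_mem[x [Vx ax] <-].
  by rewrite in_chartE// fu.
apply: smooth_on_eq => // y /set_mem[x [Vx ax] <-].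
by rewrite !in_chartE.
Qed.

Lemma smooth_in_chartL (W W' : normedModType R) (f : X -> W) (L : {linear W -> W'}) :
  continuous L -> smooth_in f -> smooth_in (fun x => L (f x)).
Proof.
move=> cL sf; have := smooth_onL Vo cL sf.
apply: smooth_on_eq => // y /set_mem[x [Vx ax] <-].
by rewrite !in_chartE.
Qed.

Lemma smooth_in_chart_cst (W : normedModType R) (w : W) : smooth_in (fun=> w).
Proof.
have := @smooth_on_cst _ _ (chart A a @` (V `&` dom A a)) _ w.
apply: smooth_on_eq => // y /set_mem[x [Vx ax] <-].
by rewrite !in_chartE.
Qed.

End SmoothMatrixInChart.

Section AtPoint.
Context {x : X}.
Local Notation trans a b := (in_chart A a (chart A b)).
Implicit Types (v w : tangent A x) (a b : idx A).

Lemma trans_comp a b c : dom A a x -> dom A b x -> dom A c x ->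
  \forall y \near chart A a x, trans b c (trans a b y) = trans a c y.
Proof.
move=> ax bx cx; apply: filterS (filterI (da_nbhs hA ax bx) (da_nbhs hA ax cx)).
move=> y [[z [az bz] <-] [z' [az' cz'] zz']].
have E := chart_eq az' az zz'; rewrite E in cz'.
by rewrite !in_chartE.
Qed.

(** The cocycle property of the differentials of coordinate changes, which makes the
   components prescribed in one chart extend to a tangent vector. *)
Lemma d_trans_comp a b c (v : 'rV[R]_m) : dom A a x -> dom A b x -> dom A c x ->
  'd (trans b c) (chart A b x) ('d (trans a b) (chart A a x) v) =
  'd (trans a c) (chart A a x) v.
Proof.
move=> ax bx cx; have d1 := da_diff hA ax bx; have d2 := da_diff hA bx cx.
have d3 := da_diff hA ax cx.
have E : trans a b (chart A a x) = chart A b x by rewrite in_chartE.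
rewrite -E in d2; rewrite -E.
apply: (etrans (diff_chain v d1 d2)); apply: etrans (deriveE v d3).
exact: near_eq_derive (trans_comp ax bx cx).
Qed.

Lemma d_trans_id a (v : 'rV[R]_m) : dom A a x ->
  'd (trans a a) (chart A a x) v = v.
Proof.
move=> ax; rewrite -deriveE; last exact: (da_diff hA).
rewrite -[RHS](derive_id (chart A a x)); apply: near_eq_derive.
by apply: filterS (da_nbhs hA ax ax) => _ [z [az _] <-]; rewrite in_chartE.
Qed.

Lemma tcoord_compat v : tangent_compat x (tcoord v : idx A -> 'rV[R]_m).
Proof. by case: v => c cP; apply/asboolP. Qed.

Lemma tcoord_trans v a b : dom A a x -> dom A b x ->
  tcoord v b = 'd (trans a b) (chart A a x) (tcoord v a).
Proof. exact: (tcoord_compat v).2. Qed.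

Lemma tcoord_inj v w a : dom A a x -> tcoord v a = tcoord w a -> v = w.
Proof.
move=> ax vw; apply/val_inj/funext => b /=.
have [bx|bx] := pselect (dom A b x); first by rewrite !(tcoord_trans _ ax bx) vw.
by rewrite (tcoord_compat v).1// (tcoord_compat w).1.
Qed.

Lemma tcoordZ k v a : tcoord (k *: v) a = k *: tcoord v a.
Proof. by []. Qed.

Lemma tcoordD v w a : tcoord (v + w) a = tcoord v a + tcoord w a.
Proof. by []. Qed.

Lemma tcoord_sum (I : finType) (f : I -> tangent A x) a :
  tcoord (\sum_i f i) a = \sum_i tcoord (f i) a.
Proof. by elim/big_rec2: _ => // i _ y _ <-; rewrite tcoordD. Qed.

Lemma tcoord_dcoord a c : dom A a x -> tcoord (dcoord A a c : tangent A x) a = c.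
Proof.
move=> ax; rewrite /dcoord; case: xgetP => [v _ //|].
pose f b := if `[< dom A b x >] then 'd (trans a b) (chart A a x) c else 0.
have fP : f \in @tangent_pred R X m A x.
  apply/asboolP; split=> [b bx|b b' bx b'x]; first by rewrite /f asboolF.
  rewrite /f (asboolT bx) (asboolT b'x); exact: esym (d_trans_comp c ax bx b'x).
by move=> /(_ (Tangent fP)); rewrite /= /f asboolT// d_trans_id.
Qed.

Lemma common_valueE (F : idx A -> tangent A x) a : dom A a x ->
  (forall b, dom A b x -> F a = F b) -> common_value A F = F a.
Proof.
move=> ax FE; rewrite /common_value; case: xgetP => [v _ /(_ _ ax)//|].
by move=> /(_ (F a)) /=; move=> /(_ FE).
Qed.

Definition frame_mx (u : 'I_m -> tangent A x) (a : idx A) : 'M[R]_m :=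
  \matrix_(i, k) tcoord (u k) a 0 i.

Lemma tcoord_fcomb u a c : (tcoord (fcomb u c) a)^T = frame_mx u a *m c.
Proof.
rewrite /fcomb tcoord_sum; apply/colP => i; rewrite !mxE summxE.
by apply: eq_bigr => k _; rewrite tcoordZ !mxE mulrC.
Qed.

Lemma frame_mx_unit u a : dom A a x -> linear_frame u -> frame_mx u a \in unitmx.
Proof.
move=> ax lu; apply: injective_unitmx => c uc0.
apply: (bij_inj lu); apply: (tcoord_inj ax); apply: trmx_inj.
by rewrite !tcoord_fcomb mulmx0.
Qed.

(** Change of basis: [P B P^-1] with [P] the matrix of the frame in the chart. *)
Lemma tcoord_frame_endo u B a v : dom A a x -> linear_frame u ->
  (tcoord (frame_endo u B v) a)^T =
  frame_mx u a *m B *m invmx (frame_mx u a) *m (tcoord v a)^T.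
Proof.
move=> ax lu; have [c ->] := frame_surj v lu.
rewrite frame_endoE// !tcoord_fcomb -!mulmxA mulKmx//.
exact: frame_mx_unit.
Qed.

End AtPoint.

Lemma frame_mx_smooth (V : set X) a (u : forall x, 'I_m -> tangent A x) :
  open (chart A a @` (V `&` dom A a)) ->
  (forall k, smooth_on (chart A a @` (V `&` dom A a))
     (in_chart A a (fun x => tcoord (u x k) a))) ->
  smooth_on (chart A a @` (V `&` dom A a)) (in_chart A a (fun x => frame_mx (u x) a)).
Proof.
move=> Vo su; apply/(smooth_in_chart_mxP Vo) => i k.
have /(smooth_in_chart_mxP Vo)/(_ 0 i) := su k.
by apply: smooth_in_chart_eq => // x _ _; rewrite mxE.
Qed.

Section SmoothFrame.
Context (V : set X) (u : forall x, 'I_m -> tangent A x).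
Hypothesis Vo : chart_open A V.
Hypothesis lu : forall x, V x -> linear_frame (u x).
Hypothesis su : forall k a, smooth_on (chart A a @` (V `&` dom A a))
     (in_chart A a (fun x => tcoord (u x k) a)).

Lemma smooth_frame_endo (B : X -> 'M[R]_m) : smooth_fun_on A V B ->
  smooth_endo_on A V (fun x => frame_endo (u x) (B x)).
Proof.
move=> sB; split=> [x Vx|a c]; first exact/frame_endo_linear/lu.
have sP := frame_mx_smooth (@Vo a) (fun k => @su k a).
have sPi := smooth_in_chart_invmx (@Vo a)
  (fun x Vx ax => frame_mx_unit ax (lu Vx)) sP.
have sE := smooth_in_chart_mulmx (@Vo a) (smooth_in_chart_mulmx (@Vo a)
  (smooth_in_chart_mulmx (@Vo a) sP (sB a)) sPi) (smooth_in_chart_cst (@Vo a) (c^T)).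
have := smooth_in_chartL (@Vo a) (@linear_mx_continuous _ _ _ _ (@trmx R _ _)) sE.
apply: smooth_in_chart_eq => // x Vx ax /=.
rewrite -[RHS]trmxK tcoord_frame_endo//; last exact: lu.
by rewrite tcoord_dcoord.
Qed.

(** Solving [E = P B P^-1] for [B] gives [B = P^-1 E P]. *)
Lemma smooth_frame_coef (E : forall x, tangent A x -> tangent A x) (B : X -> 'M[R]_m) :
  (forall x, V x -> E x = frame_endo (u x) (B x)) ->
  smooth_endo_on A V E -> smooth_fun_on A V B.
Proof.
move=> EB [_ sE] a.
have sP := frame_mx_smooth (@Vo a) (fun k => @su k a).
have sPi := smooth_in_chart_invmx (@Vo a)
  (fun x Vx ax => frame_mx_unit ax (lu Vx)) sP.
pose Em x : 'M[R]_m := \matrix_(i, j) tcoord (E x (dcoord A a (delta_mx 0 j))) a 0 i.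
have sEm : smooth_on (chart A a @` (V `&` dom A a)) (in_chart A a Em).
  apply/(smooth_in_chart_mxP (@Vo a)) => i j.
  have /(smooth_in_chart_mxP (@Vo a))/(_ 0 i) := sE a (delta_mx 0 j).
  by apply: smooth_in_chart_eq => // x _ _; rewrite mxE.
have := smooth_in_chart_mulmx (@Vo a) (smooth_in_chart_mulmx (@Vo a) sPi sEm) sP.
apply: smooth_in_chart_eq => // x Vx ax /=.
have lux := lu Vx; have Pu := frame_mx_unit ax lux.
suff -> : Em x = frame_mx (u x) a *m B x *m invmx (frame_mx (u x) a).
  by rewrite -!mulmxA mulVmx// mulmx1 mulKmx.
apply/matrixP => i j; rewrite mxE EB//.
have /matrixP/(_ i 0) := tcoord_frame_endo (B x) (dcoord A a (delta_mx 0 j)) ax lux.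
by rewrite mxE tcoord_dcoord// trmx_delta -colE !mxE => ->.
Qed.

End SmoothFrame.

End ChartedSets.

(** * Curves and 1-jets *)

Section CurveCalculus.
Context {R : realType}.

Lemma Ck_onZ (V : normedModType R) k (U : set V) p q (f : V -> R) (g : V -> 'M[R]_(p, q)) :
  open U -> Ck_on k U f -> Ck_on k U g -> Ck_on k U (fun x => f x *: g x).
Proof.
move=> Uo Cf /(Ck_on_mxP k g Uo) Cg; apply/(Ck_on_mxP k _ Uo) => i j.
have := Ck_onM Uo Cf (Cg i j); apply: Ck_on_eq => // x _.
by rewrite mxE.
Qed.

(** Along [s |-> y + h s v] the derivative of [f] is [h'] times ['D_v f], again of the
   same form, so that the induction on the order goes through. *)
Lemma smooth_on_reparam (V : normedModType R) p q (U : set V) (O : set R)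
    (f : V -> 'M[R]_(p, q)) (h : R -> R) (y v : V) :
  open O -> smooth_on U f -> smooth_on O h ->
  (forall s, O s -> U (y + h s *: v)) -> smooth_on O (fun s => f (y + h s *: v)).
Proof.
move=> Oo sf sh hU k; have {sf} := sf k; have cd := smooth_on_differentiable sh.
have dc s : O s -> differentiable (fun s => y + h s *: v) s.
  move=> Os; apply: differentiableD => //; apply: differentiableZl; exact: cd.
have Dc s r : O s -> 'D_r (fun s => y + h s *: v) s = 'D_r h s *: v.
  move=> Os; have dh := cd _ Os; rewrite (deriveE r (dc s Os)).
  have dZ := differentiableZl v dh.
  rewrite (diffD (f := cst y) _ dZ)//= diff_cst add0r (diffZl _ dh).
  by rewrite deriveE.
elim: k f => [|k IH] f.
  move=> cf s Os; apply: continuous_comp; last first.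
    by apply: cf; rewrite inE; apply: hU; rewrite -inE.
  exact/differentiable_continuous/dc/set_mem.
move=> [df Df]; split=> [s /set_mem Os|r].
  by apply: differentiable_comp (dc s Os) _; apply: df; rewrite inE; exact: hU.
have := Ck_onZ Oo (smooth_on_derive r sh k) (IH ('D_v f) (Df v)).
apply: Ck_on_eq => // s /set_mem Os.
have dfs : differentiable f (y + h s *: v) by apply: df; rewrite inE; exact: hU.
rewrite -[RHS](diff_chain r (dc s Os) dfs) -(deriveE r (dc s Os)) Dc// linearZ.
by rewrite -(deriveE v dfs).
Qed.

(** The function is [(s - t) / (1 + ((s - t) / e)^2)]; the bound is the inequality
   between arithmetic and geometric means. *)
Lemma exists_bounded_unit_speed (t e : R) : 0 < e ->
  exists h : R -> R, [/\ smooth_on setT h, h t = 0, 'D_1 h t = 1 &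
    forall s, `|h s| <= e].
Proof.
move=> e0; pose k := e^-1; have k0 : 0 < k by rewrite invr_gt0.
have ke : k * e = 1 by rewrite mulVf// gt_eqF.
pose f (s : R) := s - t; pose d (s : R) := 1 + k ^+ 2 * (f s * f s).
have d0 s : 0 < d s by rewrite ltr_wpDr// mulr_ge0 ?sqr_ge0// -expr2 sqr_ge0.
have sf : smooth_on setT f.
  apply: smooth_onD; [exact: openT| |exact: smooth_on_cst].
  by apply: (@smooth_on_linear _ R R setT idfun) => x.
have sd : smooth_on setT d.
  apply: smooth_onD; [exact: openT|exact: smooth_on_cst|].
  apply: smooth_onM; [exact: openT|exact: smooth_on_cst|].
  by apply: smooth_onM => //; exact: openT.
have sdi : smooth_on setT (fun s => (d s)^-1).
  by apply: smooth_onV => // [|x _]; [exact: openT|rewrite gt_eqF].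
have ft : f t = 0 by rewrite /f subrr.
exists (fun s => f s * (d s)^-1); split.
- by apply: smooth_onM => //; exact: openT.
- by rewrite ft mul0r.
- rewrite deriveM; last 2 first.
  + by apply: diff_derivable; apply: smooth_on_differentiable sf _.
  + by apply: diff_derivable; apply: smooth_on_differentiable sdi _.
  rewrite ft scale0r add0r /d ft mul0r mulr0 addr0 invr1 scale1r.
  rewrite /f deriveB//; first by rewrite derive_id derive_cst subr0.
- move=> s; rewrite normrM normfV (ger0_norm (ltW (d0 s))) ler_pdivrMr//.
  rewrite /d -expr2 -(real_normK (num_real (f s))).
  set w := `|f s|; have w0 : 0 <= w by exact: normr_ge0.
  have -> : e * (1 + k ^+ 2 * w ^+ 2) = e + (k * e) * k * w ^+ 2 by ring.
  rewrite ke mul1r -subr_ge0.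
  have -> : e + k * w ^+ 2 - w = k * ((w - e / 2) ^+ 2 + 3 / 4 * e ^+ 2).
    have -> : k * ((w - e / 2) ^+ 2 + 3 / 4 * e ^+ 2) =
      k * w ^+ 2 - (k * e) * w + (k * e) * e by field.
    by rewrite ke; ring.
  by rewrite mulr_ge0 ?(ltW k0)// addr_ge0 ?sqr_ge0// mulr_ge0 ?sqr_ge0// divr_ge0.
Qed.

Lemma derive1_chain (V W : normedModType R) (c : R -> V) (f : V -> W) t :
  differentiable c t -> differentiable f (c t) ->
  derive1 (fun s => f (c s)) t = 'D_(derive1 c t) f (c t).
Proof.
move=> dc df; rewrite derive1E -[LHS](diff_chain (1 : R) dc df) derive1E.
by rewrite (deriveE _ dc) (deriveE _ df).
Qed.

End CurveCalculus.

Section ManifoldCurves.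
Context {R : realType} {M : topologicalType} {n : nat} {A : atlas R M n}.
Hypothesis hM : smooth_manifold A.
Local Notation phi a b := (in_chart A a (chart A b)).

Lemma overlap_open a b : open (chart A a @` (dom A a `&` dom A b)).
Proof.
apply: (mfd_chart_open hM); first by apply: openI; exact: (mfd_dom_open hM).
by move=> x [].
Qed.

Lemma transition_smooth a b : smooth_on (chart A a @` (dom A a `&` dom A b)) (phi a b).
Proof. exact: (mfd_transition hM). Qed.

Lemma manifold_differentiable_atlas : differentiable_atlas A.
Proof.
split=> [a|a b x ax bx|a b x ax bx].
- exact: (mfd_chart_inj hM).
- by apply: open_nbhs_nbhs; split; [exact: overlap_open|exists x].
- by apply: smooth_on_differentiable (@transition_smooth a b) _; exists x.
Qed.
Local Notation hA := manifold_differentiable_atlas.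

(** A straight line in a chart may leave the chart in finite time; its parameter is
   therefore replaced by a bounded function with unit speed at [t]. *)
Lemma exists_curve a (t : R) (x : M) (v : 'rV[R]_n) : dom A a x ->
  exists g : R -> M, [/\ smooth_curve A g, g t = x &
    derive1 (fun s => chart A a (g s)) t = v].
Proof.
move=> ax; have Oo : open (chart A a @` dom A a).
  by apply: (mfd_chart_open hM) => //; exact: (mfd_dom_open hM).
have [r /= r0 rO] : nbhs_ball (chart A a x) (chart A a @` dom A a).
  by apply/nbhs_ballP/open_nbhs_nbhs; split=> //; exists x.
have v1 : 0 < `|v| + 1 by rewrite ltr_wpDl.
have e0 : 0 < r / (`|v| + 1) by rewrite divr_gt0.
have [h [sh ht Dh hb]] := exists_bounded_unit_speed t e0.
pose c s := chart A a x + h s *: v.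
have cO s : (chart A a @` dom A a) (c s).
  apply: rO; rewrite -ball_normE /ball_/= opprD addrA subrr add0r normrN normrZ.
  apply: (@le_lt_trans _ _ (r / (`|v| + 1) * `|v|)); first exact: ler_wpM2r.
  by rewrite mulrAC ltr_pdivrMr// ltr_pM2l// ltrDl.
pose g s := xget x [set q | dom A a q /\ chart A a q = c s].
have gP s : dom A a (g s) /\ chart A a (g s) = c s.
  by rewrite /g; case: xgetP => [q _ //|]; have [q aq qc] := cO s => /(_ q) [].
have cc : continuous c.
  move=> s; apply: cvgD; first exact: cvg_cst.
  by apply: continuousZr_tmp; apply: (sh 0%N); rewrite inE.
have gE s q : dom A a q -> chart A a q = c s -> g s = q.
  by move=> aq qc; have [ag gc] := gP s; apply: (chart_eq hA ag aq); rewrite gc.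
have gc : continuous g.
  move=> s W; rewrite nbhsE => -[W' [W'o W's] W'W].
  have Wo : open (chart A a @` (W' `&` dom A a)).
    by apply: (mfd_chart_open hM) => [|q []//]; apply: openI => //; exact: (mfd_dom_open hM).
  have : nbhs (c s) (chart A a @` (W' `&` dom A a)).
    by apply: open_nbhs_nbhs; split=> //; have [ag <-] := gP s; exists (g s).
  move=> /(cc s) cW; have cW' : \forall s' \near s,
    (chart A a @` (W' `&` dom A a)) (c s') by exact: cW.
  have : \forall s' \near s, W (g s'); last by [].
  by apply: filterS cW' => s' [q [Wq aq] qc]; apply: W'W; rewrite (gE _ q).
have gx : g t = x by apply: gE => //; rewrite /c ht scale0r addr0.
exists g; split=> //.
  split=> // b; pose O := g @^-1` dom A b.
  have Oo' : open O by move/continuousP: gc; apply; exact: (mfd_dom_open hM).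
  have : smooth_on O (fun s => phi a b (c s)).
    apply: smooth_on_reparam (@transition_smooth a b) _ _ => //.
      exact: smooth_onS sh.
    by move=> s Os; have [ag gcs] := gP s; exists (g s).
  apply: smooth_on_eq => // s /set_mem Os; have [ag <-] := gP s.
  by rewrite in_chartE//; exact: hA.
have -> : (fun s => chart A a (g s)) = (fun s => chart A a x + h s *: v).
  by apply/funext => s; have [] := gP s.
have dh : differentiable h t by apply: smooth_on_differentiable sh _.
have dZ := differentiableZl v dh.
rewrite derive1E deriveD//; last exact: diff_derivable.
by rewrite derive_cst add0r (deriveE _ dZ) (diffZl _ dh) -deriveE// Dh scale1r.
Qed.

Section OneCurve.
Context (g : R -> M) (sg : smooth_curve A g).

Lemma curve_chart_differentiable a s : dom A a (g s) ->
  differentiable (fun s => chart A a (g s)) s.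
Proof. by move=> ag; apply: smooth_on_differentiable (sg.2 a) _. Qed.

Lemma curve_dom_near a s : dom A a (g s) -> \forall s' \near s, dom A a (g s').
Proof.
move=> ag; apply: (sg.1 s); apply: open_nbhs_nbhs; split=> //.
exact: (mfd_dom_open hM).
Qed.

Lemma curve_velocity_trans a b s : dom A a (g s) -> dom A b (g s) ->
  derive1 (fun s => chart A b (g s)) s =
  'D_(derive1 (fun s => chart A a (g s)) s) (phi a b) (chart A a (g s)).
Proof.
move=> ag bg.
rewrite -(derive1_chain (curve_chart_differentiable ag) (da_diff hA ag bg)).
rewrite !derive1E; apply: near_eq_derive.
by apply: filterS (curve_dom_near ag) => s' ag'; rewrite in_chartE//; exact: hA.
Qed.

End OneCurve.

Lemma same_jet_sym r t g h : same_jet A r t g h -> same_jet A r t h g.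
Proof. by move=> [gh E]; split=> // a ah k kr; rewrite E ?gh. Qed.

Lemma same_jet_trans r t g h l :
  same_jet A r t g h -> same_jet A r t h l -> same_jet A r t g l.
Proof.
move=> [gh E] [hl F]; split=> [|a ag k kr]; first by rewrite gh.
by rewrite E// F// -gh.
Qed.

(** Equality of 1-jets in one chart implies it in all charts by the chain rule. *)
Lemma same_jet1 a t g h : smooth_curve A g -> smooth_curve A h ->
  dom A a (g t) -> g t = h t ->
  derive1 (fun s => chart A a (g s)) t = derive1 (fun s => chart A a (h s)) t ->
  same_jet A 1 t g h.
Proof.
move=> sg sh ag gh E; split; first exact: gh.
move=> b bg k; case: k => [|k] k1; last (case: k k1 => [|k] k1; last discriminate k1).
  by change (chart A b (g t) = chart A b (h t)); rewrite gh.
change (derive1 (fun s => chart A b (g s)) t = derive1 (fun s => chart A b (h s)) t).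
rewrite (curve_velocity_trans sg ag bg).
have ah : dom A a (h t) by rewrite -gh.
have bh : dom A b (h t) by rewrite -gh.
apply: etrans (esym (curve_velocity_trans sh ah bh)).
by rewrite E gh.
Qed.

Lemma jet_class_eq r t g h : same_jet A r t g h -> jet_class A r t g = jet_class A r t h.
Proof.
move=> gh; apply/seteqP; split=> l [sl gl]; split=> //.
  exact: same_jet_trans (same_jet_sym gh) gl.
exact: same_jet_trans gh gl.
Qed.

Lemma jrep_cls r (j : jet A r) : jcls j = jet_class A r (jtime j) (jrep j).
Proof. by rewrite /jrep; case: cid2. Qed.

Lemma jet_eq r (j j' : jet A r) : jtime j = jtime j' ->
  same_jet A r (jtime j) (jrep j) (jrep j') -> j = j'.
Proof.
move=> tE /jet_class_eq; rewrite -jrep_cls tE -jrep_cls.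
case: j j' tE => [t c cP] [t' c' cP'] /= tt' cc'; subst t' c'.
by congr Jet; exact: Prop_irrelevance.
Qed.

Lemma jrep_jet_of r t g (sg : smooth_curve A g) :
  same_jet A r t (jrep (jet_of r t sg)) g.
Proof.
have : jet_class A r t g g by split.
by rewrite -[jet_class _ _ _ _]/(jcls (jet_of r t sg)) jrep_cls => -[].
Qed.

Lemma jpoint_jet_of r t g (sg : smooth_curve A g) : jpoint (jet_of r t sg) = g t.
Proof. exact: (jrep_jet_of r t sg).1. Qed.

Lemma jcoord_jet_of r t g (sg : smooth_curve A g) k a : (k <= r)%N -> dom A a (g t) ->
  jcoord k a (jet_of r t sg) = derive1n k (fun s => chart A a (g s)) t.
Proof.
move=> kr ag; have := (jrep_jet_of r t sg).2 a; apply=> //.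
by rewrite (jrep_jet_of r t sg).1.
Qed.

Lemma jcoord0 r a (j : jet A r) : jcoord 0 a j = chart A a (jpoint j).
Proof. by []. Qed.

Lemma jcoord1_trans a b (j : jet A 1) : dom A a (jpoint j) -> dom A b (jpoint j) ->
  jcoord 1 b j = 'D_(jcoord 1 a j) (phi a b) (chart A a (jpoint j)).
Proof. by move=> aj bj; have := curve_velocity_trans (jrep_smooth j) aj bj. Qed.

Lemma jet1_eq a (j j' : jet A 1) : dom A a (jpoint j) -> dom A a (jpoint j') ->
  jtime j = jtime j' -> jcoord 0 a j = jcoord 0 a j' -> jcoord 1 a j = jcoord 1 a j' ->
  j = j'.
Proof.
move=> aj aj' tE; rewrite !jcoord0 => /(chart_eq hA aj aj') xE vE.
apply: jet_eq => //; apply: (same_jet1 (a := a)); [exact: jrep_smooth|exact: jrep_smooth|by []| |].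
  by rewrite -[LHS]/(jpoint j) xE tE.
by rewrite [LHS]vE tE.
Qed.

Lemma exists_jet1 a (t : R) (x : M) (v : 'rV[R]_n) : dom A a x ->
  exists j : jet A 1, [/\ jtime j = t, jpoint j = x & jcoord 1 a j = v].
Proof.
move=> ax; have [g [sg gx gv]] := exists_curve t v ax.
exists (jet_of 1 t sg); split=> //; first by rewrite jpoint_jet_of.
by rewrite jcoord_jet_of// gx.
Qed.

End ManifoldCurves.

(** * Charts of the jet manifold *)

Section RowCalculus.
Context {R : realType} {V : normedModType R}.

Lemma differentiableZ_mx p q (k : V -> R) (g : V -> 'M[R]_(p, q)) x :
  differentiable k x -> differentiable g x -> differentiable (fun y => k y *: g y) x.
Proof.
move=> dk /differentiable_mxP dg; apply/differentiable_mxP => i j.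
have := differentiableM dk (dg i j); apply: near_eq_differentiable.
by near=> y; rewrite mxE.
Unshelve. all: by end_near. Qed.

Lemma deriveZ_mx p q (k : V -> R) (g : V -> 'M[R]_(p, q)) x w :
  differentiable k x -> differentiable g x ->
  'D_w (fun y => k y *: g y) x = k x *: 'D_w g x + 'D_w k x *: g x.
Proof.
move=> dk dg; have dkg := differentiableZ_mx dk dg.
have dgij := (differentiable_mxP g x).1 dg.
apply/matrixP => i j; rewrite (derive_mx (diff_derivable (v := w) dkg)) mxE.
rewrite (_ : (fun t => _) = k * (fun y => g y i j)); last first.
  by apply/funext => y; rewrite mxE.
rewrite deriveM; [|exact: diff_derivable|exact: diff_derivable].
rewrite (derive_mx (diff_derivable (v := w) dg)) !mxE.
by congr (_ + _); rewrite [LHS]mulrC.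
Qed.

Lemma row_mx_congr p q1 q2 (a a' : 'M[R]_(p, q1)) (b b' : 'M[R]_(p, q2)) :
  a = a' -> b = b' -> row_mx a b = row_mx a' b'.
Proof. by move=> -> ->. Qed.

Lemma differentiable_row_mx p q1 q2 (f : V -> 'M[R]_(p, q1)) (g : V -> 'M[R]_(p, q2)) x :
  differentiable f x -> differentiable g x ->
  differentiable (fun y => row_mx (f y) (g y)) x.
Proof.
move=> /differentiable_mxP df /differentiable_mxP dg; apply/differentiable_mxP => i j.
case: (split_ordP j) => [k ->|k ->].
  have := df i k; apply: near_eq_differentiable.
  by near=> y; rewrite row_mxEl.
have := dg i k; apply: near_eq_differentiable.
by near=> y; rewrite row_mxEr.
Unshelve. all: by end_near. Qed.

Lemma derive_row_mx p q1 q2 (f : V -> 'M[R]_(p, q1)) (g : V -> 'M[R]_(p, q2)) x w :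
  differentiable f x -> differentiable g x ->
  'D_w (fun y => row_mx (f y) (g y)) x = row_mx ('D_w f x) ('D_w g x).
Proof.
move=> df dg; have dfg := differentiable_row_mx df dg.
apply/matrixP => i j; rewrite (derive_mx (diff_derivable (v := w) dfg)) mxE.
case: (split_ordP j) => [k ->|k ->].
  rewrite row_mxEl (derive_mx (diff_derivable (v := w) df)) mxE.
  rewrite (_ : (fun y => _) = (fun y => f y i k))//.
  by apply/funext => y; rewrite row_mxEl.
rewrite row_mxEr (derive_mx (diff_derivable (v := w) dg)) mxE.
rewrite (_ : (fun y => _) = (fun y => g y i k))//.
by apply/funext => y; rewrite row_mxEr.
Qed.

Lemma derive_sumZ (V' : normedModType R) p q m (f : V' -> 'M[R]_(p, q)) x (v : 'I_m -> V') (c : 'I_m -> R) :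
  differentiable f x ->
  'D_(\sum_i c i *: v i) f x = \sum_i c i *: 'D_(v i) f x.
Proof.
move=> df; rewrite deriveE// linear_sum; apply: eq_bigr => i _.
by rewrite linearZ deriveE.
Qed.

(** For [f] a coordinate change, [X] the position and [L] the velocity, the function
   differentiated here is the velocity component of the induced change on 1-jets.
   It is written as the sum of [L z 0 i *: 'D_(delta_mx 0 i) f (X z)] to be
   differentiated as a product. *)
Lemma derive_prolong p q n (U : set 'rV[R]_n) (f : 'rV[R]_n -> 'M[R]_(p, q))
    (X L : {linear V -> 'rV[R]_n}) y :
  continuous X -> continuous L -> open U -> U (X y) -> Ck_on 2 U f ->
  differentiable (fun z => 'D_(L z) f (X z)) y /\
  forall w, 'D_w (fun z => 'D_(L z) f (X z)) y =
    'D_(X w) ('D_(L y) f) (X y) + 'D_(L w) f (X y).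
Proof.
move=> cX cL Uo Uy Cf; have df z : U z -> differentiable f z.
  by move=> Uz; apply: Cf.1; rewrite inE.
have ddf v z : U z -> differentiable ('D_v f) z.
  by move=> Uz; apply: (Cf.2 v).1; rewrite inE.
have LE z x : U x -> 'D_(L z) f x = \sum_i L z 0 i *: 'D_(delta_mx 0 i) f x.
  move=> Ux; apply: etrans (congr1 (fun l => 'D_l f x) (row_sum_delta (L z))) _.
  by apply: derive_sumZ; exact: df.
pose F z := \sum_i L z 0 i *: 'D_(delta_mx 0 i) f (X z).
have XU : \forall z \near y, U (X z).
  by apply: cX; exact: open_nbhs_nbhs.
have E : \forall z \near y, F z = 'D_(L z) f (X z).
  apply: filterS XU => z Uz; exact: esym (LE z (X z) Uz).
have dk i : differentiable (fun z => L z 0 i) y.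
  exact: differentiable_comp (linear_differentiable y cL) (@differentiable_coord R _ _ _ 0 i).
have dg i : differentiable (fun z => 'D_(delta_mx 0 i) f (X z)) y.
  exact: differentiable_comp (linear_differentiable y cX) (ddf _ _ Uy).
have dS i := differentiableZ_mx (dk i) (dg i).
have FE : F = \sum_i (fun z => L z 0 i *: 'D_(delta_mx 0 i) f (X z)).
  by apply/funext => z; rewrite fct_sumE.
split=> [|w].
  by apply: near_eq_differentiable E _; rewrite FE; exact: differentiable_sum.
rewrite -(near_eq_derive w E) FE derive_sum => [|i]; last exact: diff_derivable.
have DL i : 'D_w (fun z => L z 0 i) y = L w 0 i.
  have dL := diff_derivable (v := w) (linear_differentiable y cL).
  by rewrite -[in RHS](derive_linear w y cL) (derive_mx dL) mxE.
have DE i : 'D_w (fun z => L z 0 i *: 'D_(delta_mx 0 i) f (X z)) y =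
    L y 0 i *: 'D_(X w) ('D_(delta_mx 0 i) f) (X y) + L w 0 i *: 'D_(delta_mx 0 i) f (X y).
  apply: etrans (deriveZ_mx w (dk i) (dg i)) _.
  have -> := derive_comp_linear ('D_(delta_mx 0 i) f) X w y.
  by have -> := DL i.
transitivity (\sum_i (L y 0 i *: 'D_(X w) ('D_(delta_mx 0 i) f) (X y) +
    L w 0 i *: 'D_(delta_mx 0 i) f (X y))); first by apply: eq_bigr => i _; exact: DE.
rewrite big_split/=; congr (_ + _); last exact: esym (LE w (X y) Uy).
have UX : \forall x \near X y, \sum_i L y 0 i *: 'D_(delta_mx 0 i) f x = 'D_(L y) f x.
  apply: filterS (open_nbhs_nbhs (conj Uo Uy)) => x Ux; exact: esym (LE y x Ux).
rewrite -(near_eq_derive (X w) UX).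
rewrite (_ : (fun x => _) = \sum_i (L y 0 i *: 'D_(delta_mx 0 i) f)); last first.
  by apply/funext => x; rewrite fct_sumE.
rewrite derive_sum => [|i]; last exact/derivableZ/diff_derivable/ddf.
by apply: eq_bigr => i _; rewrite deriveZ//; exact/diff_derivable/ddf.
Qed.

End RowCalculus.

Section JetCharts.
Context {R : realType} {M : topologicalType} {n : nat} {A : atlas R M n}.
Hypothesis hM : smooth_manifold A.
Let hA := manifold_differentiable_atlas hM.
Local Notation phi a b := (in_chart A a (chart A b)).
Local Notation A1 := (atlas1 A).
Local Notation A0 := (atlas0 A).
Local Notation dom1 := (dom A1).
Local Notation J := (jet A 1).

Definition tpart : {linear 'rV[R]_(1 + (n + n)) -> 'rV[R]_1} := lsubmx.
Definition xpart : {linear 'rV[R]_(1 + (n + n)) -> 'rV[R]_n} := lsubmx \o rsubmx.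
Definition vpart : {linear 'rV[R]_(1 + (n + n)) -> 'rV[R]_n} := rsubmx \o rsubmx.
Definition jet_row (t : 'rV[R]_1) (x v : 'rV[R]_n) : 'rV[R]_(1 + (n + n)) :=
  row_mx t (row_mx x v).

Lemma tpart_row t x v : tpart (jet_row t x v) = t.
Proof. by rewrite /tpart/= row_mxKl. Qed.
Lemma xpart_row t x v : xpart (jet_row t x v) = x.
Proof. by rewrite /xpart/= row_mxKr row_mxKl. Qed.
Lemma vpart_row t x v : vpart (jet_row t x v) = v.
Proof. by rewrite /vpart/= !row_mxKr. Qed.
Lemma jet_row_parts y : jet_row (tpart y) (xpart y) (vpart y) = y.
Proof. by rewrite /jet_row /tpart /xpart /vpart/= !hsubmxK. Qed.

Lemma chart1E a (j : J) : chart A1 a j =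
  jet_row (jtime j)%:M (chart A a (jpoint j)) (jcoord 1 a j).
Proof. by []. Qed.

Lemma chart1_inj a : {in dom1 a &, injective (chart A1 a)}.
Proof.
move=> j j' /set_mem aj /set_mem aj'; rewrite !chart1E => /eq_row_mx[tE /eq_row_mx[xE vE]].
apply: (jet1_eq hM (a := a)) => //.
by move/matrixP: tE => /(_ 0 0); rewrite !mxE.
Qed.

(** Every 1-jet with prescribed coordinates exists, so the image of a chart is
   constrained in the position component only. *)
Lemma chart1_image (W : set M) a :
  chart A1 a @` [set j : J | W (jpoint j) /\ dom A a (jpoint j)] =
  xpart @^-1` (chart A a @` (W `&` dom A a)).
Proof.
apply/seteqP; split=> [_ [j [Wj aj] <-]|y [x [Wx ax] xE]].
  by exists (jpoint j) => //; rewrite chart1E xpart_row.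
have [j [tj jx jv]] := exists_jet1 hM (tpart y 0 0) (vpart y) ax.
exists j; first by rewrite /= jx.
by rewrite chart1E tj jx jv xE -mx11_scalar jet_row_parts.
Qed.

Lemma xpart_continuous : continuous xpart.
Proof. exact: linear_mx_continuous. Qed.
Lemma vpart_continuous : continuous vpart.
Proof. exact: linear_mx_continuous. Qed.
Lemma tpart_continuous : continuous tpart.
Proof. exact: linear_mx_continuous. Qed.

Lemma overlap1E a b : chart A1 a @` (dom1 a `&` dom1 b) =
  xpart @^-1` (chart A a @` (dom A a `&` dom A b)).
Proof.
rewrite (setIC (dom A a)) -chart1_image; congr (_ @` _).
by apply/seteqP; split=> j [].
Qed.

Lemma overlap1_open a b : open (chart A1 a @` (dom1 a `&` dom1 b)).
Proof.
rewrite overlap1E; have /continuousP := xpart_continuous; apply.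
exact: overlap_open.
Qed.

Lemma trans1E a b y : (chart A1 a @` (dom1 a `&` dom1 b)) y ->
  in_chart A1 a (chart A1 b) y =
  jet_row (tpart y) (phi a b (xpart y)) ('D_(vpart y) (phi a b) (xpart y)).
Proof.
move=> [j [aj bj] <-]; rewrite (in_chart_injE _ (@chart1_inj a) aj).
rewrite [chart A1 a j]chart1E tpart_row xpart_row vpart_row chart1E.
by rewrite (jcoord1_trans hM aj bj) in_chartE.
Qed.

Lemma trans1_diff a b (j : J) : dom1 a j -> dom1 b j ->
  differentiable (in_chart A1 a (chart A1 b)) (chart A1 a j) /\
  forall w, 'D_w (in_chart A1 a (chart A1 b)) (chart A1 a j) =
    jet_row (tpart w) ('D_(xpart w) (phi a b) (chart A a (jpoint j)))
      ('D_(xpart w) ('D_(jcoord 1 a j) (phi a b)) (chart A a (jpoint j)) +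
       'D_(vpart w) (phi a b) (chart A a (jpoint j))).
Proof.
move=> aj bj; set y := chart A1 a j.
have yx : xpart y = chart A a (jpoint j) by rewrite /y chart1E xpart_row.
have yv : vpart y = jcoord 1 a j by rewrite /y chart1E vpart_row.
rewrite -yx -yv.
pose O := chart A a @` (dom A a `&` dom A b).
have Oy : O (xpart y) by rewrite yx; exists (jpoint j).
have Oo : open O by exact: overlap_open.
have sphi := transition_smooth hM a b.
have [dP DP] := derive_prolong (V := 'rV[R]_(1 + (n + n)))
  xpart_continuous vpart_continuous Oo Oy (sphi 2%N).
have dX := linear_differentiable y xpart_continuous.
have dT := linear_differentiable y tpart_continuous.
have dphi : differentiable (phi a b) (xpart y).
  exact: smooth_on_differentiable sphi Oy.
have dF : differentiable (fun z => phi a b (xpart z)) y.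
  exact: differentiable_comp dX dphi.
have dXV := differentiable_row_mx dF dP.
have dAll := differentiable_row_mx dT dXV.
have E : \forall z \near y, row_mx (tpart z) (row_mx (phi a b (xpart z))
     ('D_(vpart z) (phi a b) (xpart z))) = in_chart A1 a (chart A1 b) z.
  have : nbhs y (chart A1 a @` (dom1 a `&` dom1 b)).
    by apply: open_nbhs_nbhs; split; [exact: overlap1_open|exists j].
  by apply: filterS => z /trans1E->.
split=> [|w]; first exact: near_eq_differentiable E dAll.
rewrite -(near_eq_derive w E) (derive_row_mx w dT dXV) (derive_row_mx w dF dP).
have e1 := derive_linear w y tpart_continuous.
have e2 := derive_comp_linear (phi a b) xpart w y.
apply: row_mx_congr; first exact: e1.
apply: row_mx_congr; [exact: e2|exact: DP].
Qed.

Lemma atlas1_differentiable : differentiable_atlas A1.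
Proof.
split=> [a|a b j aj bj|a b j aj bj]; first exact: chart1_inj.
  by apply: open_nbhs_nbhs; split; [exact: overlap1_open|exists j].
by have [] := trans1_diff aj bj.
Qed.
Let hA1 := atlas1_differentiable.

Lemma dom1_chart_open a : chart_open A1 (dom1 a).
Proof. by move=> b; rewrite setIC; exact: overlap1_open. Qed.

Lemma trans1_row a b (j : J) t x v : dom1 a j -> dom1 b j ->
  'D_(jet_row t x v) (in_chart A1 a (chart A1 b)) (chart A1 a j) =
  jet_row t ('D_x (phi a b) (chart A a (jpoint j)))
    ('D_x ('D_(jcoord 1 a j) (phi a b)) (chart A a (jpoint j)) +
     'D_v (phi a b) (chart A a (jpoint j))).
Proof.
move=> aj bj; have [_ D] := trans1_diff aj bj.
have D' w t' x' v' : tpart w = t' -> xpart w = x' -> vpart w = v' ->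
    'D_w (in_chart A1 a (chart A1 b)) (chart A1 a j) =
    jet_row t' ('D_x' (phi a b) (chart A a (jpoint j)))
      ('D_x' ('D_(jcoord 1 a j) (phi a b)) (chart A a (jpoint j)) +
       'D_v' (phi a b) (chart A a (jpoint j))).
  by move=> <- <- <-; exact: D.
exact: D' (tpart_row _ _ _) (xpart_row _ _ _) (vpart_row _ _ _).
Qed.

Lemma tcoord1_trans (j : J) (u : tangent A1 j) a b t x v : dom1 a j -> dom1 b j ->
  tcoord u a = jet_row t x v ->
  tcoord u b = jet_row t ('D_x (phi a b) (chart A a (jpoint j)))
    ('D_x ('D_(jcoord 1 a j) (phi a b)) (chart A a (jpoint j)) +
     'D_v (phi a b) (chart A a (jpoint j))).
Proof.
move=> aj bj ua; have [d _] := trans1_diff aj bj.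
apply: etrans (tcoord_trans u aj bj) _; rewrite ua.
exact: etrans (esym (deriveE _ d)) (trans1_row _ _ _ aj bj).
Qed.

Lemma chart0_inj a : {in dom A0 a &, injective (chart A0 a)}.
Proof.
move=> [t x] [t' x'] /set_mem ax /set_mem ax' /eq_row_mx[tE /= xE].
have -> : x = x' by exact: (chart_eq hA ax ax').
by move/matrixP: tE => /(_ 0 0); rewrite !mxE /= !mulr1n => ->.
Qed.

Definition tpart0 : {linear 'rV[R]_(1 + n) -> 'rV[R]_1} := lsubmx.
Definition xpart0 : {linear 'rV[R]_(1 + n) -> 'rV[R]_n} := rsubmx.

Lemma overlap0E a b : chart A0 a @` (dom A0 a `&` dom A0 b) =
  xpart0 @^-1` (chart A a @` (dom A a `&` dom A b)).
Proof.
apply/seteqP; split=> [_ [[t x] [ax bx] <-]|y [x [ax bx] xE]].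
  by exists x => //; rewrite /xpart0/= row_mxKr.
exists (tpart0 y 0 0, x) => //=.
by rewrite xE -mx11_scalar /tpart0 /xpart0/= hsubmxK.
Qed.

Lemma overlap0_open a b : open (chart A0 a @` (dom A0 a `&` dom A0 b)).
Proof.
rewrite overlap0E; have /continuousP := @linear_mx_continuous R _ _ _ xpart0; apply.
exact: overlap_open.
Qed.

Lemma trans0_diff a b q : dom A0 a q -> dom A0 b q ->
  differentiable (in_chart A0 a (chart A0 b)) (chart A0 a q) /\
  forall w, 'D_w (in_chart A0 a (chart A0 b)) (chart A0 a q) =
    row_mx (tpart0 w) ('D_(xpart0 w) (phi a b) (chart A a q.2)).
Proof.
move=> aq bq; set y := chart A0 a q.
have yx : xpart0 y = chart A a q.2 by rewrite /y /xpart0 /= row_mxKr.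
have dX := linear_mx_differentiable xpart0 y.
have dT := linear_mx_differentiable tpart0 y.
have dphi : differentiable (phi a b) (xpart0 y).
  by rewrite yx; exact: (da_diff hA).
have dF : differentiable (fun z => phi a b (xpart0 z)) y.
  exact: differentiable_comp dX dphi.
have dAll := differentiable_row_mx dT dF.
have E : \forall z \near y, row_mx (tpart0 z) (phi a b (xpart0 z)) =
    in_chart A0 a (chart A0 b) z.
  have : nbhs y (chart A0 a @` (dom A0 a `&` dom A0 b)).
    by apply: open_nbhs_nbhs; split; [exact: overlap0_open|exists q].
  apply: filterS => _ [[t x] [ax bx] <-].
  rewrite (in_chart_injE _ (@chart0_inj a) ax).
  by rewrite /tpart0 /xpart0 /= row_mxKl row_mxKr in_chartE.
split=> [|w]; first exact: near_eq_differentiable E dAll.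
rewrite -(near_eq_derive w E) (derive_row_mx w dT dF) -yx; congr (row_mx _ _).
  exact: derive_linear (@linear_mx_continuous _ _ _ _ _).
exact: derive_comp_linear.
Qed.

Lemma atlas0_differentiable : differentiable_atlas A0.
Proof.
split=> [a|a b j aj bj|a b j aj bj]; first exact: chart0_inj.
  by apply: open_nbhs_nbhs; split; [exact: overlap0_open|exists j].
by have [] := trans0_diff aj bj.
Qed.

End JetCharts.

(** * The forces of a second-order equation under coordinate changes *)

Lemma addr_congr (V : zmodType) (a a' b b' : V) : a = a' -> b = b' -> a + b = a' + b'.
Proof. by move=> -> ->. Qed.

(** The expansion of the second derivative [D_(v + k w) D_(v + k w)] in powers of
   [k], with [B'] and [B] its two mixed terms. *)
Lemma expand_square (R : realType) (V : lmodType R) (D1 D2 P B B' C : V) (k : R) :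
  D1 = P + k *: B -> D2 = B' + k *: C -> B' = B ->
  D1 + k *: D2 = P + k *: (B *+ 2) + (k * k) *: C.
Proof. by move=> -> -> ->; rewrite mulr2n !scalerDr scalerA !addrA. Qed.

Section SodeGeometry.
Context {R : realType} {M : topologicalType} {n : nat} {A : atlas R M n}.
Hypothesis hM : smooth_manifold A.
Let hA := manifold_differentiable_atlas hM.
Let hA1 := atlas1_differentiable hM.
Let hA0 := atlas0_differentiable hM.
Local Notation phi a b := (in_chart A a (chart A b)).
Local Notation A1 := (atlas1 A).
Local Notation A0 := (atlas0 A).
Local Notation dom1 := (dom A1).
Local Notation J := (jet A 1).

Section Prolongation.
Context (g : R -> M) (sg : smooth_curve A g).
Local Notation ga a := (fun s => chart A a (g s)).

Definition prolong a (s : R) := jet_row s%:M (ga a s) (derive1 (ga a) s).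

Lemma chart1_prolong a s : dom A a (g s) ->
  chart A1 a (jet_of 1 s sg) = prolong a s.
Proof.
move=> ag; have e1 := jpoint_jet_of 1 s sg.
have e2 := jcoord_jet_of sg (k := 1) (r := 1) (a := a) (leqnn 1) ag.
by rewrite chart1E e1 e2.
Qed.

Lemma prolong_diff a t : dom A a (g t) -> differentiable (prolong a) t /\
  derive1 (prolong a) t = jet_row 1%:M (derive1 (ga a) t) (derive1n 2 (ga a) t).
Proof.
move=> ag; have sga := sg.2 a.
have d1 : differentiable (ga a) t by exact: smooth_on_differentiable sga ag.
have D1E : derive1 (ga a) = 'D_1 (ga a) by apply/funext => s; exact: derive1E.
have d2 : differentiable (derive1 (ga a)) t.
  by rewrite D1E; exact: smooth_on_derive_differentiable sga ag.
have sE : (fun s : R => s%:M : 'M[R]_1) = (fun s => s *: 1%:M).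
  by apply/funext => s; rewrite scale_scalar_mx mulr1.
have d0 : differentiable (fun s : R => s%:M : 'M[R]_1) t.
  by rewrite sE; apply: differentiableZl.
have d12 := differentiable_row_mx d1 d2.
split; first exact: differentiable_row_mx d0 d12.
rewrite derive1E; apply: etrans (derive_row_mx _ d0 d12) _.
apply: row_mx_congr.
  by rewrite sE deriveE; [rewrite diff_val /= scale1r|exact: differentiableZl].
apply: etrans (derive_row_mx _ d1 d2) _.
by apply: row_mx_congr; rewrite -derive1E.
Qed.

(** Both sides are velocities of the prolonged curve, read in the charts [a] and [b]. *)
Lemma prolong_trans a b t : dom A a (g t) -> dom A b (g t) ->
  'D_(jet_row 1%:M (derive1 (ga a) t) (derive1n 2 (ga a) t))
    (in_chart A1 a (chart A1 b)) (chart A1 a (jet_of 1 t sg)) =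
  jet_row 1%:M (derive1 (ga b) t) (derive1n 2 (ga b) t).
Proof.
move=> ag bg; have [dca <-] := prolong_diff ag; have [_ <-] := prolong_diff bg.
have aj : dom1 a (jet_of 1 t sg) by rewrite /= jpoint_jet_of.
have bj : dom1 b (jet_of 1 t sg) by rewrite /= jpoint_jet_of.
have dT := da_diff hA1 aj bj.
move: dT; rewrite (chart1_prolong ag) => dT.
rewrite -(derive1_chain dca dT) !derive1E.
apply: near_eq_derive.
apply: filterS2 (curve_dom_near hM sg ag) (curve_dom_near hM sg bg) => s ags bgs.
rewrite -(chart1_prolong ags) -(chart1_prolong bgs).
apply: (in_chartE hA1); by rewrite /= jpoint_jet_of.
Qed.

End Prolongation.

Context (sigma : jet A 1 -> jet A 2).
Hypothesis hsigma : is_sode sigma.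

Lemma jpoint_sode xi : jpoint (sigma xi) = jpoint xi.
Proof. by rewrite -{2}(hsigma.2 xi) /p21 jpoint_jet_of. Qed.

Lemma jcoord1_sode a xi : dom1 a xi -> jcoord 1 a (sigma xi) = jcoord 1 a xi.
Proof.
move=> axi; have as_ : dom A a (jrep (sigma xi) (jtime (sigma xi))).
  by rewrite -[jrep _ _]/(jpoint _) jpoint_sode.
rewrite -[in RHS](hsigma.2 xi) /p21.
by have -> := jcoord_jet_of (jrep_smooth (sigma xi)) (leqnn 1) as_.
Qed.

Lemma chart1_range_open a : open (chart A1 a @` dom1 a).
Proof. by have := @overlap1_open _ _ _ _ hM a a; rewrite setIid. Qed.

Local Notation F a := (sodeF sigma a).
Local Notation G a := (in_chart A1 a (F a)).
Local Notation O a := (chart A1 a @` dom1 a).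

Lemma in_chart1E (W : nmodType) (f : J -> W) a xi : dom1 a xi ->
  in_chart A1 a f (chart A1 a xi) = f xi.
Proof. by move=> axi; exact: (in_chartE hA1). Qed.

Lemma sodeF_smooth a : smooth_on (O a) (G a).
Proof.
have [_ sm] := hsigma.1 a a.
have UE : dom1 a `&` sigma @^-1` dom (atlas2 A) a = dom1 a.
  by apply/seteqP; split=> [j []//|j aj]; split=> //; rewrite /= jpoint_sode.
rewrite UE in sm.
pose L : {linear 'rV[R]_(1 + (n + (n + n))) -> 'rV[R]_n} := rsubmx \o (rsubmx \o rsubmx).
have cL : continuous L by exact: linear_mx_continuous.
have := smooth_onL (@chart1_range_open a) cL sm.
apply: (smooth_on_eq (@chart1_range_open a)) => _ /set_mem[j aj <-].
by rewrite !in_chart1E// /L /= !row_mxKr.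
Qed.

Lemma sodeF_diff a xi : dom1 a xi -> differentiable (G a) (chart A1 a xi).
Proof. by move=> axi; apply: smooth_on_differentiable (@sodeF_smooth a) _; exists xi. Qed.

Lemma sode_row_trans a b xi : dom1 a xi -> dom1 b xi ->
  'D_(jet_row 1%:M (jcoord 1 a xi) (F a xi)) (in_chart A1 a (chart A1 b)) (chart A1 a xi) =
  jet_row 1%:M (jcoord 1 b xi) (F b xi).
Proof.
move=> axi bxi.
have ag : dom A a (jrep (sigma xi) (jtime (sigma xi))).
  by rewrite -[jrep _ _]/(jpoint _) jpoint_sode.
have bg : dom A b (jrep (sigma xi) (jtime (sigma xi))).
  by rewrite -[jrep _ _]/(jpoint _) jpoint_sode.
have := prolong_trans (jrep_smooth (sigma xi)) ag bg.
rewrite -[jet_of _ _ _]/(p21 (sigma xi)) hsigma.2.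
by rewrite -(jcoord1_sode axi) -(jcoord1_sode bxi).
Qed.

(** The last component of the invariance of [X^sigma]. *)
Lemma sodeF_trans a b xi : dom1 a xi -> dom1 b xi ->
  F b xi = 'D_(jcoord 1 a xi) ('D_(jcoord 1 a xi) (phi a b)) (chart A a (jpoint xi)) +
    'D_(F a xi) (phi a b) (chart A a (jpoint xi)).
Proof.
move=> axi bxi.
have := etrans (esym (sode_row_trans axi bxi)) (trans1_row hM _ _ _ axi bxi).
by move=> /eq_row_mx[_ /eq_row_mx[_]].
Qed.

Lemma sodeF_trans_at a b xi v q : dom1 a xi -> dom1 b xi ->
  jcoord 1 a xi = v -> jpoint xi = q ->
  F b xi = 'D_v ('D_v (phi a b)) (chart A a q) + 'D_(F a xi) (phi a b) (chart A a q).
Proof. by move=> axi bxi <- <-; exact: sodeF_trans. Qed.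

(** The derivative of the forces in the direction [w] of the fibre of 1-jets over
   0-jets; its components are the partial derivatives of the forces with respect to
   the velocities. *)
Definition dF a (xi : J) (w : 'rV[R]_n) := 'D_(jet_row 0 0 w) (G a) (chart A1 a xi).

Lemma jet_row0 : jet_row 0 0 0 = 0 :> 'rV[R]_(1 + (n + n)).
Proof. by rewrite /jet_row !row_mx0. Qed.

Lemma jet_rowZ k t x v :
  k *: jet_row t x v = jet_row (k *: t) (k *: x) (k *: v) :> 'rV[R]_(1 + (n + n)).
Proof. by rewrite /jet_row !scale_row_mx. Qed.

Lemma jet_rowD t x v t' x' v' :
  jet_row t x v + jet_row t' x' v' =
  jet_row (t + t') (x + x') (v + v') :> 'rV[R]_(1 + (n + n)).
Proof. by rewrite /jet_row !add_row_mx. Qed.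

Lemma jet_row_sum (I : finType) (t : I -> 'rV[R]_1) (x v : I -> 'rV[R]_n) :
  \sum_i jet_row (t i) (x i) (v i) =
  jet_row (\sum_i t i) (\sum_i x i) (\sum_i v i).
Proof.
suff H (r : seq I) : \sum_(i <- r) jet_row (t i) (x i) (v i) =
    jet_row (\sum_(i <- r) t i) (\sum_(i <- r) x i) (\sum_(i <- r) v i) by exact: H.
elim: r => [|i r IH]; first by rewrite !big_nil jet_row0.
by rewrite !big_cons IH jet_rowD.
Qed.

(** The transformation law of the forces is restricted to the line
   [k |-> (t, x, v + k w)], where it is a quadratic polynomial in [k] plus the image
   of the forces under the differential of the coordinate change; the coefficient of
   [k] is twice a mixed derivative by symmetry. *)
Lemma dF_trans a b xi w : dom1 a xi -> dom1 b xi ->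
  dF b xi ('D_w (phi a b) (chart A a (jpoint xi))) =
  'D_w ('D_(jcoord 1 a xi) (phi a b)) (chart A a (jpoint xi)) *+ 2 +
  'D_(dF a xi w) (phi a b) (chart A a (jpoint xi)).
Proof.
move=> axi bxi; set x := chart A a (jpoint xi); set v := jcoord 1 a xi.
set w' := 'D_w (phi a b) x.
have Ox : (chart A a @` (dom A a `&` dom A b)) x by exists (jpoint xi).
have Oo := @overlap_open _ _ _ _ hM a b.
have sphi := transition_smooth hM a b.
have dphi : differentiable (phi a b) x by exact: smooth_on_differentiable sphi Ox.
have ddphi l : differentiable ('D_l (phi a b)) x.
  exact: smooth_on_derive_differentiable sphi Ox.
have H1 l l' (k : R) : 'D_(l + k *: l') (phi a b) x =
    'D_l (phi a b) x + k *: 'D_l' (phi a b) x by exact: derive_affine_direction.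
have H2 l l' (k : R) r : 'D_r ('D_(l + k *: l') (phi a b)) x =
    'D_r ('D_l (phi a b)) x + k *: 'D_r ('D_l' (phi a b)) x.
  exact: derive2_affine_direction Oo Ox sphi.
have H3 r r' (k : R) l : 'D_(r + k *: r') ('D_l (phi a b)) x =
    'D_r ('D_l (phi a b)) x + k *: 'D_r' ('D_l (phi a b)) x by exact: derive_affine_direction.
(* The line is the set of 1-jets [xk] over a fixed 0-jet, and its image is a line. *)
have line (k : R) : G b (chart A1 b xi + k *: jet_row 0 0 w') =
    ('D_v ('D_v (phi a b)) x + k *: ('D_w ('D_v (phi a b)) x *+ 2) +
     (k * k) *: 'D_w ('D_w (phi a b)) x) +
    'd (phi a b) x (G a (chart A1 a xi + k *: jet_row 0 0 w)).
  have [xk [tk jk vk]] := exists_jet1 hM (jtime xi) (v + k *: w) axi.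
  have axk : dom1 a xk by rewrite /= jk.
  have bxk : dom1 b xk by rewrite /= jk.
  have ca : chart A1 a xi + k *: jet_row 0 0 w = chart A1 a xk.
    by rewrite !chart1E tk jk vk jet_rowZ jet_rowD !scaler0 !addr0.
  have vbk : jcoord 1 b xk = jcoord 1 b xi + k *: w'.
    rewrite (jcoord1_trans hM axk bxk) vk jk (jcoord1_trans hM axi bxi).
    exact: H1.
  have cb : chart A1 b xi + k *: jet_row 0 0 w' = chart A1 b xk.
    by rewrite !chart1E tk jk vbk jet_rowZ jet_rowD !scaler0 !addr0.
  have eb : G b (chart A1 b xi + k *: jet_row 0 0 w') = F b xk.
    by rewrite cb; exact: in_chart1E.
  have ea : G a (chart A1 a xi + k *: jet_row 0 0 w) = F a xk.
    by rewrite ca; exact: in_chart1E.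
  have sw : 'D_v ('D_w (phi a b)) x = 'D_w ('D_v (phi a b)) x.
    exact: mixed_derivativeC Oo Ox (sphi 2%N).
  have Q : 'D_(v + k *: w) ('D_(v + k *: w) (phi a b)) x =
      'D_v ('D_v (phi a b)) x + k *: ('D_w ('D_v (phi a b)) x *+ 2) +
      (k * k) *: 'D_w ('D_w (phi a b)) x.
    apply: etrans (H2 _ _ _ _) _.
    exact: expand_square (H3 v w k v) (H3 v w k w) sw.
  rewrite eb ea; apply: etrans (sodeF_trans_at axk bxk vk jk) _.
  exact: addr_congr Q (deriveE _ dphi).
have [dga ga] := is_derive_line0 (diff_derivable (v := jet_row 0 0 w) (sodeF_diff axi)).
have [dgb gb] := is_derive_line0 (diff_derivable (v := jet_row 0 0 w') (sodeF_diff bxi)).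
have cdphi : continuous ('d (phi a b) x) by exact: linear_mx_continuous.
have lineE := funext line.
apply: etrans (esym gb) _.
apply: etrans (congr1 (fun f : R -> 'rV[R]_n => 'D_1 f (0 : R)) lineE) _.
apply: etrans (derive_quadratic_linear _ _ _ cdphi dga) _.
apply: addr_congr; first by [].
by apply: etrans (congr1 ('d (phi a b) x) ga) _; exact: esym (deriveE _ dphi).
Qed.

End SodeGeometry.

(** * The adapted frame of a chart *)

Lemma addrDKK (V : zmodType) (p q g : V) : p + q + g - p - q = g.
Proof. by rewrite [p + q + g]addrC -addrA -opprD addrK. Qed.

Lemma addrDBB (V : zmodType) (p q g : V) : p + q + (g - p - q) = g.
Proof. by rewrite -(addrA g) -opprD subrKC. Qed.

Section Shear.
Context {R : realType} {n : nat} (v f : 'rV[R]_n) (h : 'rV[R]_n -> 'rV[R]_n).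

(** The components of a vector in terms of its coefficients [al], [be], [ga] with
   respect to the frame of a chart, where [v] is the velocity, [f] the force and [h]
   its derivative along the fibre. *)
Definition shear (al : 'cV[R]_1) (be ga : 'cV[R]_n) : 'rV[R]_(1 + (n + n)) :=
  jet_row al^T (al 0 0 *: v + be^T) (al 0 0 *: f + 2^-1 *: h be^T + ga^T).

(** The shear is unipotent in block form, so it is inverted by substitution. *)
Definition shear_inv (y : 'rV[R]_(1 + (n + n))) : 'cV[R]_(1 + (n + n)) :=
  let t := (tpart y)^T in let x := xpart y - t 0 0 *: v in
  col_mx t (col_mx x^T (vpart y - t 0 0 *: f - 2^-1 *: h x)^T).

Lemma shear_invK al be ga : shear_inv (shear al be ga) = col_mx al (col_mx be ga).
Proof.
rewrite /shear_inv /shear tpart_row xpart_row vpart_row trmxK.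
rewrite [al 0 0 *: v + _]addrC addrK trmxK; congr (col_mx _ (col_mx _ _)).
by rewrite addrDKK trmxK.
Qed.

Lemma shearK y :
  let t := (tpart y)^T in let x := xpart y - t 0 0 *: v in
  shear t x^T (vpart y - t 0 0 *: f - 2^-1 *: h x)^T = y.
Proof. by move=> t x; rewrite /shear !trmxK subrKC addrDBB jet_row_parts. Qed.

End Shear.

Section SodeFrame.
Context {R : realType} {M : topologicalType} {n : nat} {A : atlas R M n}.
Hypothesis hM : smooth_manifold A.
Let hA := manifold_differentiable_atlas hM.
Let hA1 := atlas1_differentiable hM.
Let hA0 := atlas0_differentiable hM.
Local Notation phi a b := (in_chart A a (chart A b)).
Local Notation A1 := (atlas1 A).
Local Notation A0 := (atlas0 A).
Local Notation dom1 := (dom A1).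
Local Notation J := (jet A 1).
Context (sigma : jet A 1 -> jet A 2).
Hypothesis hsigma : is_sode sigma.
Local Notation F a := (sodeF sigma a).
Local Notation G a := (in_chart A1 a (F a)).
Local Notation O a := (chart A1 a @` dom1 a).
Local Notation base a xi := (chart A a (jpoint xi)).

Lemma transition_differentiable a b (xi : J) : dom1 a xi -> dom1 b xi -> differentiable (phi a b) (base a xi).
Proof. by move=> axi bxi; exact: (da_diff hA axi bxi). Qed.

Lemma tcoord_sum_dx a (xi : J) (c : 'rV[R]_n) : dom1 a xi ->
  tcoord (\sum_i c 0 i *: d_x xi a i) a = jet_row 0 c 0.
Proof.
move=> axi; rewrite tcoord_sum.
transitivity (\sum_i jet_row 0 (c 0 i *: delta_mx 0 i) 0 : 'rV[R]_(1 + (n + n))).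
  apply: eq_bigr => i _; rewrite tcoordZ (tcoord_dcoord hA1 _ axi).
  by apply: etrans (jet_rowZ _ _ _ _) _; rewrite !scaler0.
by rewrite jet_row_sum !big1_eq -row_sum_delta.
Qed.

Lemma tcoord_sum_dxdot a (xi : J) (c : 'rV[R]_n) : dom1 a xi ->
  tcoord (\sum_i c 0 i *: d_xdot xi a i) a = jet_row 0 0 c.
Proof.
move=> axi; rewrite tcoord_sum.
transitivity (\sum_i jet_row 0 0 (c 0 i *: delta_mx 0 i) : 'rV[R]_(1 + (n + n))).
  apply: eq_bigr => i _; rewrite tcoordZ (tcoord_dcoord hA1 _ axi).
  by apply: etrans (jet_rowZ _ _ _ _) _; rewrite !scaler0.
by rewrite jet_row_sum !big1_eq -row_sum_delta.
Qed.

(** The local expressions of [X^sigma] agree on overlaps, so that it has the expected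
   components in every chart. *)
Lemma tcoord_Xsigma a xi : dom1 a xi ->
  tcoord (Xsigma sigma xi) a = jet_row 1%:M (jcoord 1 a xi) (F a xi).
Proof.
move=> axi.
pose X b := d_t xi b + \sum_i (jcoord 1 b xi) 0 i *: d_x xi b i
    + \sum_i (F b xi) 0 i *: d_xdot xi b i.
have XE b : dom1 b xi -> tcoord (X b) b = jet_row 1%:M (jcoord 1 b xi) (F b xi).
  move=> bxi; rewrite !tcoordD tcoord_sum_dx// tcoord_sum_dxdot//.
  rewrite (tcoord_dcoord hA1 _ bxi) -[row_mx 1%:M 0](_ : jet_row 1%:M 0 0 = _).
    by rewrite !jet_rowD !addr0 !add0r.
  by rewrite /jet_row row_mx0.
rewrite /Xsigma (common_valueE (A := A1) (F := X) axi); first exact: XE.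
move=> b bxi; apply: (tcoord_inj bxi); rewrite XE//.
apply: etrans (tcoord1_trans hM axi bxi (XE a axi)) _.
apply: etrans (esym (trans1_row hM _ _ _ axi bxi)) _.
exact: sode_row_trans.
Qed.

Lemma dF_sum a xi (c : 'rV[R]_n) : dom1 a xi ->
  dF sigma a xi c = \sum_i c 0 i *: dF sigma a xi (delta_mx 0 i).
Proof.
move=> axi; have dG := sodeF_diff hM hsigma axi.
have := derive_sumZ (fun i => jet_row 0 0 (delta_mx 0 i)) (fun i => c 0 i) dG.
move=> H; apply: etrans H; rewrite /dF; congr ('D_ _ _ _).
under eq_bigr do rewrite jet_rowZ !scaler0.
by rewrite jet_row_sum !big1_eq -row_sum_delta.
Qed.

Lemma tcoord_Xsigma_i a xi i : dom1 a xi -> tcoord (Xsigma_i sigma xi a i) a =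
  jet_row 0 (delta_mx 0 i) (2^-1 *: dF sigma a xi (delta_mx 0 i)).
Proof.
move=> axi; rewrite tcoordD tcoordZ (tcoord_dcoord hA1 _ axi).
have := @tcoord_sum_dxdot a xi (dF sigma a xi (delta_mx 0 i)) axi; rewrite /dF => ->.
by rewrite jet_rowZ -/(jet_row 0 (delta_mx 0 i) 0) jet_rowD !scaler0 !addr0 add0r.
Qed.

(** The vector of the middle summand whose coefficients are [c]: the horizontal lift
   of the tangent vector of [M] with components [c] in the chart [a]. *)
Definition Xsum a xi (c : 'rV[R]_n) := \sum_i c 0 i *: Xsigma_i sigma xi a i.

Lemma tcoord_Xsum a xi c : dom1 a xi ->
  tcoord (Xsum a xi c) a = jet_row 0 c (2^-1 *: dF sigma a xi c).
Proof.
move=> axi; rewrite tcoord_sum.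
transitivity (\sum_i jet_row 0 (c 0 i *: delta_mx 0 i)
    (2^-1 *: (c 0 i *: dF sigma a xi (delta_mx 0 i)))).
  apply: eq_bigr => i _; rewrite tcoordZ tcoord_Xsigma_i//.
  by rewrite jet_rowZ scaler0 !scalerA [c 0 i * _]mulrC.
by rewrite jet_row_sum big1_eq -row_sum_delta (dF_sum c axi) scaler_sumr.
Qed.

Lemma half_double (V : lmodType R) (B C D : V) :
  D = B *+ 2 + C -> B + 2^-1 *: C = 2^-1 *: D.
Proof.
by move=> ->; rewrite scalerDr -[B *+ 2]scaler_nat scalerA mulVf ?scale1r// pnatr_eq0.
Qed.

(** The horizontal lift is intrinsic.  The factor 1/2 in [X^sigma_i] cancels the
   factor 2 in front of the mixed derivative in [dF_trans]. *)
Lemma Xsum_trans a b xi c : dom1 a xi -> dom1 b xi ->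
  Xsum a xi c = Xsum b xi ('D_c (phi a b) (base a xi)).
Proof.
move=> axi bxi; apply: (tcoord_inj bxi).
apply: etrans (tcoord1_trans hM axi bxi (tcoord_Xsum c axi)) _.
rewrite (tcoord_Xsum _ bxi); congr (jet_row _ _ _).
apply: etrans _ (half_double (dF_trans hM hsigma c axi bxi)).
apply: addr_congr => //.
have dphi := transition_differentiable axi bxi.
apply: etrans (deriveE _ dphi) _; apply: etrans (linearZ _ _) _.
by congr (_ *: _); exact: esym (deriveE _ dphi).
Qed.

Lemma vertical_trans a b xi (u : tangent A1 xi) c : dom1 a xi -> dom1 b xi ->
  tcoord u a = jet_row 0 0 c ->
  tcoord u b = jet_row 0 0 ('D_c (phi a b) (base a xi)).
Proof.
move=> axi bxi ua; apply: etrans (tcoord1_trans hM axi bxi ua) _.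
congr (jet_row _ _ _); first exact: derive0.
by rewrite derive0 add0r.
Qed.

Lemma tcoord_d_trans xi (w : tangent A (p10 xi).2) a b : dom1 a xi -> dom1 b xi ->
  tcoord w b = 'D_(tcoord w a) (phi a b) (base a xi).
Proof.
move=> axi bxi; apply: etrans (tcoord_trans w (a := a) (b := b) axi bxi) _.
exact: esym (deriveE _ (transition_differentiable axi bxi)).
Qed.

Lemma tcoord_eps a xi (w : tangent A (p10 xi).2) : dom1 a xi ->
  tcoord (eps w) a = jet_row 0 0 (tcoord w a).
Proof.
move=> axi; pose X b := \sum_i (tcoord w b) 0 i *: d_xdot xi b i.
rewrite /eps (common_valueE (A := A1) (F := X) axi); first exact: tcoord_sum_dxdot.
move=> b bxi; apply: (tcoord_inj bxi); rewrite /X (tcoord_sum_dxdot _ bxi).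
apply: etrans (vertical_trans axi bxi (tcoord_sum_dxdot _ axi)) _.
by congr (jet_row _ _ _); exact: esym (tcoord_d_trans w axi bxi).
Qed.

Lemma eps_invK a xi (w : tangent A (p10 xi).2) : dom1 a xi -> eps_inv (eps w) = w.
Proof.
move=> axi; rewrite /eps_inv; case: xgetP => [w' _ /=|/(_ w) []//].
move=> e; have := congr1 (fun u => vpart (tcoord u a)) e.
rewrite (tcoord_eps w' axi) (tcoord_eps w axi) => E.
apply: (tcoord_inj (A := A) (a := a) axi).
exact: etrans (esym (vpart_row _ _ _)) (etrans E (vpart_row _ _ _)).
Qed.

Lemma tcoord_space_incl a (xi : J) (w : tangent A (p10 xi).2) : dom1 a xi ->
  tcoord (space_incl w) a = row_mx 0 (tcoord w a).
Proof.
move=> axi; pose X b : tangent A0 (p10 xi) := dcoord A0 b (row_mx 0 (tcoord w b)).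
have axi0 : dom A0 a (p10 xi) by [].
rewrite /space_incl (common_valueE (A := A0) (F := X) axi0); first exact: (tcoord_dcoord hA0).
move=> b bxi; apply: (tcoord_inj bxi).
rewrite /X (tcoord_dcoord hA0 _ bxi) (tcoord_trans _ axi0 bxi) (tcoord_dcoord hA0 _ axi0).
have [d D] := trans0_diff hM axi0 bxi.
apply: etrans (esym (deriveE _ d)) _; apply: etrans (D _) _.
rewrite /tpart0 /= row_mxKl; apply: row_mx_congr => //.
rewrite /xpart0 /= row_mxKr; exact: esym (tcoord_d_trans w axi bxi).
Qed.

Lemma Hsigma_space_incl a xi (w : tangent A (p10 xi).2) : dom1 a xi ->
  Hsigma sigma (space_incl w) = Xsum a xi (tcoord w a).
Proof.
move=> axi; pose X b := dt_form b (space_incl w) *: Xsigma sigma xi +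
  \sum_i omega b (space_incl w) i *: Xsigma_i sigma xi b i.
have XE b : dom1 b xi -> X b = Xsum b xi (tcoord w b).
  move=> bxi; rewrite /X /omega /dt_form /dx_form (tcoord_space_incl w bxi).
  rewrite row_mxEl mxE scale0r add0r; apply: eq_bigr => i _.
  by rewrite row_mxEr mulr0 subr0.
rewrite /Hsigma (common_valueE (A := A1) (F := X) axi); first exact: XE.
move=> b bxi; rewrite !XE//; apply: etrans (Xsum_trans _ axi bxi) _.
by congr (Xsum _ _ _); exact: esym (tcoord_d_trans w axi bxi).
Qed.

(** On vertical vectors [eps^-1] is defined and [H^sigma] has no [dt] part, so what
   remains is the horizontal lift. *)
Lemma Heps_vertical a xi (c : 'rV[R]_n) : dom1 a xi ->
  Heps sigma (\sum_i c 0 i *: d_xdot xi a i) = Xsum a xi c.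
Proof.
move=> axi; pose w : tangent A (p10 xi).2 := dcoord A a c.
have wc : tcoord w a = c by exact: (tcoord_dcoord hA).
have -> : \sum_i c 0 i *: d_xdot xi a i = eps w.
  by apply: (tcoord_inj axi); rewrite tcoord_sum_dxdot// tcoord_eps// wc.
by rewrite /Heps (eps_invK w axi) (Hsigma_space_incl w axi) wc.
Qed.

Lemma p10_diff a b (xi : J) : dom1 a xi -> dom1 b xi ->
  differentiable (in_chart A1 a (fun y => chart A0 b (p10 y))) (chart A1 a xi) /\
  forall w, 'D_w (in_chart A1 a (fun y => chart A0 b (p10 y))) (chart A1 a xi) =
    row_mx (tpart w) ('D_(xpart w) (phi a b) (base a xi)).
Proof.
move=> axi bxi; set y := chart A1 a xi.
have yx : xpart y = base a xi by rewrite /y chart1E xpart_row.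
have dX := linear_differentiable y xpart_continuous.
have dT := linear_differentiable y tpart_continuous.
have dphi : differentiable (phi a b) (xpart y) by rewrite yx; exact: transition_differentiable.
have dF : differentiable (fun z => phi a b (xpart z)) y.
  exact: differentiable_comp dX dphi.
have dAll := differentiable_row_mx dT dF.
have E : \forall z \near y, row_mx (tpart z) (phi a b (xpart z)) =
    in_chart A1 a (fun y => chart A0 b (p10 y)) z.
  have : nbhs y (chart A1 a @` (dom1 a `&` dom1 b)).
    by apply: open_nbhs_nbhs; split; [exact: overlap1_open|exists xi].
  apply: filterS => _ [j [aj bj] <-].
  rewrite (in_chartE hA1 _ aj) chart1E tpart_row xpart_row (in_chartE hA)//.
split=> [|w]; first exact: near_eq_differentiable E dAll.
rewrite -(near_eq_derive w E); apply: etrans (derive_row_mx w dT dF) _.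
apply: row_mx_congr; first exact: derive_linear tpart_continuous.
by rewrite -yx; exact: derive_comp_linear.
Qed.

(** In coordinates [p10] is [(t, x, v) |-> (t, phi x)] with [phi] a coordinate change
   of [M], whose differential is injective. *)
Lemma TplusP a xi v : dom1 a xi ->
  Tplus A xi v <-> exists c : 'rV[R]_n, v = \sum_i c 0 i *: d_xdot xi a i.
Proof.
move=> axi; split=> [Tv|[c ->] a' b a'xi bxi]; last first.
  have [d D] := p10_diff a'xi bxi; apply: etrans (esym (deriveE _ d)) _.
  rewrite (vertical_trans axi a'xi (tcoord_sum_dxdot c axi)).
  apply: etrans (D _) _; rewrite tpart_row xpart_row.
  by have -> : 'D_0 (phi a' b) (base a' xi) = 0; [exact: derive0|exact: row_mx0].
exists (vpart (tcoord v a)); apply: (tcoord_inj axi); rewrite tcoord_sum_dxdot//.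
have [d D] := p10_diff axi axi.
have := Tv a a axi axi; rewrite -(deriveE _ d) D => /eqP.
rewrite row_mx_eq0 => /andP[/eqP t0 /eqP x0].
have dphi := transition_differentiable axi axi.
have x00 : xpart (tcoord v a) = 0.
  apply: etrans (esym (d_trans_id hA _ axi)) _.
  exact: etrans (esym (deriveE _ dphi)) x0.
apply: etrans (esym (jet_row_parts _)) _.
by congr (jet_row _ _ _); [exact: t0|exact: x00].
Qed.

(** The definition asks for coefficients in every chart; by [Xsum_trans] those in one
   chart suffice. *)
Lemma TminusP a xi v : dom1 a xi ->
  @Tminus R M n A sigma xi v <-> exists c : 'rV[R]_n, v = Xsum a xi c.
Proof.
move=> axi; split=> [/(_ a axi)//|[c ->] b bxi].
by exists ('D_c (phi a b) (base a xi)); exact: Xsum_trans.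
Qed.

Definition sode_frame a (xi : J) (k : 'I_(1 + (n + n))) : tangent A1 xi :=
  match fintype.split k with
  | inl _ => Xsigma sigma xi
  | inr k' => match fintype.split k' with
              | inl i => Xsigma_i sigma xi a i
              | inr i => d_xdot xi a i
              end
  end.

Lemma sode_frame0 a xi : sode_frame a xi (lshift (n + n) 0) = Xsigma sigma xi.
Proof. by rewrite /sode_frame -[lshift _ _]/(unsplit (inl _)) unsplitK. Qed.
Lemma sode_frameM a xi i : sode_frame a xi (rshift 1 (lshift n i)) = Xsigma_i sigma xi a i.
Proof. by rewrite /sode_frame -[rshift _ _]/(unsplit (inr _)) unsplitK -[lshift _ _]/(unsplit (inl _)) unsplitK. Qed.
Lemma sode_frameP a xi i : sode_frame a xi (rshift 1 (rshift n i)) = d_xdot xi a i.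
Proof. by rewrite /sode_frame -[rshift 1 _]/(unsplit (inr _)) unsplitK -[rshift _ _]/(unsplit (inr _)) unsplitK. Qed.

Lemma sum_sode_frameM a xi (c : 'cV[R]_n) :
  \sum_i c i 0 *: sode_frame a xi (rshift 1 (lshift n i)) = Xsum a xi c^T.
Proof. by apply: eq_bigr => i _; rewrite sode_frameM mxE. Qed.

Lemma sum_sode_frameP a xi (c : 'cV[R]_n) :
  \sum_i c i 0 *: sode_frame a xi (rshift 1 (rshift n i)) =
  \sum_i c^T 0 i *: d_xdot xi a i.
Proof. by apply: eq_bigr => i _; rewrite sode_frameP mxE. Qed.

Lemma tcoord_sode_frame a xi (al : 'cV[R]_1) (be ga : 'cV[R]_n) : dom1 a xi ->
  tcoord (fcomb (sode_frame a xi) (col_mx al (col_mx be ga))) a =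
  shear (jcoord 1 a xi) (F a xi) (dF sigma a xi) al be ga.
Proof.
move=> axi; rewrite fcomb_split sode_frame0 sum_sode_frameM sum_sode_frameP.
rewrite !tcoordD tcoordZ tcoord_Xsigma// tcoord_Xsum// tcoord_sum_dxdot//.
rewrite jet_rowZ !jet_rowD !addr0 scale_scalar_mx mulr1; congr (jet_row _ _ _).
by rewrite [RHS]mx11_scalar mxE.
Qed.

Lemma sode_frame_linear_frame a xi : dom1 a xi -> linear_frame (sode_frame a xi).
Proof.
move=> axi.
exists (fun v => shear_inv (jcoord 1 a xi) (F a xi) (dF sigma a xi) (tcoord v a)) => [c|v].
  by rewrite {1}(cV_split c) tcoord_sode_frame// shear_invK -cV_split.
apply: (tcoord_inj axi); apply: etrans (tcoord_sode_frame _ _ _ axi) _.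
exact: shearK.
Qed.

Lemma sode_splitting_frame a xi : dom1 a xi ->
  splitting_frame (sode_frame a xi) (@Tzero R M n A sigma xi) (@Tminus R M n A sigma xi)
    (Tplus A xi) (@Heps R M n A sigma xi).
Proof.
move=> axi; split; first exact: sode_frame_linear_frame.
- by move=> v; rewrite sode_frame0.
- move=> v; apply: iff_trans (TminusP v axi) _.
  split=> -[c ->]; first by exists c^T; rewrite sum_sode_frameM trmxK.
  by exists c^T; rewrite sum_sode_frameM.
- move=> v; apply: iff_trans (TplusP v axi) _.
  split=> -[c ->]; first by exists c^T; rewrite sum_sode_frameP trmxK.
  by exists c^T; rewrite sum_sode_frameP.
- by move=> c; rewrite sum_sode_frameP Heps_vertical// sum_sode_frameM.
Qed.

Lemma sode_frame_adapted a xi : dom1 a xi -> adapted sigma (sode_frame a xi).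
Proof.
move=> axi; split; first exact: sode_frame_linear_frame.
- exact: sode_frame0.
- move=> i; apply/(TplusP _ axi); exists (delta_mx 0 i).
  rewrite sode_frameP (bigD1 i)//= mxE !eqxx scale1r big1 ?addr0// => j ji.
  by rewrite mxE (negbTE ji) andbF scale0r.
- move=> i.
  have dE (f : 'I_n -> tangent A1 xi) : \sum_j (delta_mx 0 i : 'rV[R]_n) 0 j *: f j = f i.
    rewrite (bigD1 i)//= mxE !eqxx scale1r big1 ?addr0// => j ji.
    by rewrite mxE (negbTE ji) andbF scale0r.
  rewrite sode_frameP sode_frameM -(dE (d_xdot xi a)) Heps_vertical//.
  by rewrite /Xsum dE.
Qed.

Section FrameSmooth.
Context (a b : idx A).
Local Notation D := (chart A1 b @` (dom1 a `&` dom1 b)).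

Let Do : open D.
Proof. by rewrite setIC; exact: overlap1_open. Qed.

Definition velocity_jacobian (xi : J) : 'M[R]_n :=
  \matrix_(i, j) ('D_(delta_mx 0 i) (phi a b) (base a xi)) 0 j.

Lemma velocity_jacobian_row xi i :
  row i (velocity_jacobian xi) = 'D_(delta_mx 0 i) (phi a b) (base a xi).
Proof. by apply/rowP => j; rewrite !mxE. Qed.

(** As a function on the chart [b] this matrix is the inverse of the Jacobian of the
   change from [b] to [a], which is smooth in the coordinates of [b]. *)
Lemma velocity_jacobian_smooth : smooth_on D (in_chart A1 b velocity_jacobian).
Proof.
pose K (x : 'rV[R]_n) : 'M[R]_n :=
  \matrix_(i, j) ('D_(delta_mx 0 i) (phi b a) x) 0 j.
pose Ob := chart A b @` (dom A b `&` dom A a).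
have Obo : open Ob by exact: overlap_open.
have sK : smooth_on Ob K.
  apply/(smooth_on_mxP Obo) => i j.
  have /(smooth_on_mxP Obo)/(_ 0 j) :=
    smooth_on_derive (delta_mx 0 i) (transition_smooth hM b a).
  by apply: (smooth_on_eq Obo) => x _; rewrite mxE.
have sKx := smooth_on_comp_linear xpart_continuous sK.
have DE : D = xpart @^-1` Ob by rewrite setIC overlap1E.
rewrite -DE in sKx.
have KJ xi : dom1 a xi -> dom1 b xi ->
    velocity_jacobian xi *m K (base b xi) = 1%:M.
  move=> axi bxi; apply/row_matrixP => i; rewrite row_mul velocity_jacobian_row.
  have d1 := transition_differentiable axi bxi; have d2 := transition_differentiable bxi axi.
  set l := 'D_(delta_mx 0 i) (phi a b) (base a xi).
  have -> : l *m K (base b xi) = 'D_l (phi b a) (base b xi).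
    rewrite -[in RHS](mul1mx l) [in RHS](row_sum_delta (1%:M *m l)) mul1mx.
    apply: etrans _ (esym (derive_sumZ _ _ d2)); rewrite mulmx_sum_row.
    by apply: eq_bigr => j _; congr (_ *: _); apply/rowP => k; rewrite !mxE.
  rewrite row1; apply: etrans (deriveE _ d2) _.
  have lE : l = 'd (phi a b) (base a xi) (delta_mx 0 i) by exact: deriveE.
  rewrite lE; apply: etrans (d_trans_comp hA _ axi bxi axi) _.
  exact: (d_trans_id hA).
have KI xi : dom1 a xi -> dom1 b xi ->
    K (base b xi) \in unitmx /\ velocity_jacobian xi = invmx (K (base b xi)).
  move=> axi bxi; have H := KJ _ axi bxi; have [_ u] := mulmx1_unit H.
  by split=> //; rewrite -[LHS](mulmxK u) H mul1mx.
have := smooth_on_invmx Do _ sKx.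
have H : {in D, forall y, K (xpart y) \in unitmx}.
  move=> _ /set_mem[xi [axi bxi] <-]; rewrite chart1E xpart_row.
  by have [] := KI _ axi bxi.
move=> /(_ H); apply: (smooth_on_eq Do) => _ /set_mem[xi [axi bxi] <-].
rewrite (in_chartE hA1)// chart1E xpart_row.
by have [_ ->] := KI _ axi bxi.
Qed.

Lemma smooth_jet_row (t : J -> 'rV[R]_1) (x v : J -> 'rV[R]_n) :
  smooth_on D (in_chart A1 b t) -> smooth_on D (in_chart A1 b x) ->
  smooth_on D (in_chart A1 b v) ->
  smooth_on D (in_chart A1 b (fun xi => jet_row (t xi) (x xi) (v xi))).
Proof.
move=> st sx sv; apply/(smooth_in_chart_mxP hA1 Do) => i j.
case: (split_ordP j) => [k ->|k ->]; last case: (split_ordP k) => [l ->|l ->].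
- have /(smooth_in_chart_mxP hA1 Do)/(_ i k) := st.
  by apply: (smooth_in_chart_eq hA1 Do) => xi _ _; rewrite /jet_row row_mxEl.
- have /(smooth_in_chart_mxP hA1 Do)/(_ i l) := sx.
  by apply: (smooth_in_chart_eq hA1 Do) => xi _ _; rewrite /jet_row row_mxEr row_mxEl.
- have /(smooth_in_chart_mxP hA1 Do)/(_ i l) := sv.
  by apply: (smooth_in_chart_eq hA1 Do) => xi _ _; rewrite /jet_row !row_mxEr.
Qed.

Lemma overlap_sub_range : D `<=` O b.
Proof. by move=> _ [xi [_ bxi] <-]; exists xi. Qed.

Lemma smooth_dF (l : J -> 'rV[R]_n) : smooth_on D (in_chart A1 b l) ->
  smooth_on D (in_chart A1 b (fun xi => dF sigma b xi (l xi))).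
Proof.
move=> sl.
have sG : smooth_on D (G b) := smooth_onS overlap_sub_range (sodeF_smooth hM hsigma b).
have : smooth_on D (fun y => \sum_i (in_chart A1 b l y) 0 i *:
    'D_(jet_row 0 0 (delta_mx 0 i)) (G b) y).
  apply: (smooth_on_sum Do) => i; apply: (smooth_onZ Do).
    by have /(smooth_on_mxP Do) := sl; apply.
  exact: smooth_on_derive.
apply: (smooth_on_eq Do) => _ /set_mem[xi [axi bxi] <-].
by rewrite !(in_chartE hA1)// (dF_sum (l xi) bxi).
Qed.

Lemma smooth_overlap_cst (W : normedModType R) (w : W) : smooth_on D (in_chart A1 b (fun=> w)).
Proof. exact: (smooth_in_chart_cst hA1 Do). Qed.

(** In the chart [b] the frame of the chart [a] has components [(1, v, F_b)],
   [(0, l, d F_b l / 2)] and [(0, 0, l)], with [l] running through the rows of the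
   velocity Jacobian. *)
Lemma sode_frame_smooth k :
  smooth_on D (in_chart A1 b (fun xi => tcoord (sode_frame a xi k) b)).
Proof.
have sJ i : smooth_on D (in_chart A1 b (fun xi => row i (velocity_jacobian xi))).
  apply/(smooth_in_chart_mxP hA1 Do) => u j.
  have /(smooth_in_chart_mxP hA1 Do)/(_ i j) := velocity_jacobian_smooth.
  by apply: (smooth_in_chart_eq hA1 Do) => xi _ _; rewrite [RHS]mxE.
have dE i (T : lmodType R) (f : 'I_n -> T) : \sum_j (delta_mx 0 i : 'rV[R]_n) 0 j *: f j = f i.
  rewrite (bigD1 i)//= mxE !eqxx scale1r big1 ?addr0// => j ji.
  by rewrite mxE (negbTE ji) andbF scale0r.
case: (split_ordP k) => [j ->|j ->]; last case: (split_ordP j) => [i ->|i ->].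
- have sv : smooth_on D (in_chart A1 b (fun xi => jcoord 1 b xi)).
    have : smooth_on D (vpart : 'rV[R]_(1 + (n + n)) -> 'rV[R]_n).
      exact: smooth_on_linear vpart_continuous.
    apply: (smooth_on_eq Do) => _ /set_mem[xi [axi bxi] <-].
    by rewrite (in_chartE hA1)// chart1E vpart_row.
  have sF : smooth_on D (G b) := smooth_onS overlap_sub_range (sodeF_smooth hM hsigma b).
  have := smooth_jet_row (smooth_overlap_cst 1%:M) sv sF.
  apply: (smooth_in_chart_eq hA1 Do) => xi axi bxi.
  by rewrite (ord1 j) sode_frame0 tcoord_Xsigma.
- have s2 : smooth_on D (in_chart A1 b
      (fun xi => 2^-1 *: dF sigma b xi (row i (velocity_jacobian xi)))).
    have := smooth_onZ Do (@smooth_on_cst R _ D _ (2^-1 : R)) (smooth_dF (sJ i)).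
    apply: (smooth_on_eq Do) => _ /set_mem[xi [axi bxi] <-].
    by rewrite !(in_chartE hA1).
  have := smooth_jet_row (smooth_overlap_cst 0) (sJ i) s2.
  apply: (smooth_in_chart_eq hA1 Do) => xi axi bxi.
  rewrite sode_frameM velocity_jacobian_row -(tcoord_Xsum _ bxi) -(Xsum_trans _ axi bxi).
  by rewrite /Xsum dE.
- have := smooth_jet_row (smooth_overlap_cst 0) (smooth_overlap_cst 0) (sJ i).
  apply: (smooth_in_chart_eq hA1 Do) => xi axi bxi.
  rewrite sode_frameP velocity_jacobian_row; apply: esym.
  apply: (vertical_trans axi bxi); rewrite -(tcoord_sum_dxdot _ axi).
  by rewrite dE.
Qed.

End FrameSmooth.

End SodeFrame.

(** * The adjoint bundle *)

Section AdjointAlgebra.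
Context {R : realType} {n : nat}.
Local Notation N := (1 + (n + n))%N.

Lemma gdiag_sum (I : finType) (k : I -> R) (L : I -> 'M[R]_n) :
  gdiag (\sum_i k i *: L i) = \sum_i k i *: gdiag (L i).
Proof.
suff H (r : seq I) : gdiag (\sum_(i <- r) k i *: L i) = \sum_(i <- r) k i *: gdiag (L i).
  exact: H.
elim: r => [|i r IH]; last by rewrite !big_cons gdiag_linear IH.
by rewrite !big_nil /gdiag !block_mx0.
Qed.

Lemma invmx_mul p (g h : 'M[R]_p) : g \in unitmx -> h \in unitmx ->
  invmx (g *m h) = invmx h *m invmx g.
Proof.
move=> gu hu; have ghu : g *m h \in unitmx by rewrite unitmx_mul gu.
apply: (can_inj (mulKmx ghu)); rewrite mulmxV// mulmxA mulmxK//.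
by rewrite mulmxV.
Qed.

Lemma Gmx_mulmx (L L' : 'M[R]_n) : Gmx L *m Gmx L' = Gmx (L *m L').
Proof.
by rewrite /Gmx !mulmx_block !mulmx0 !mul0mx mul1mx !(addr0, add0r).
Qed.

Lemma Gmx1 : Gmx 1%:M = 1%:M :> 'M[R]_N.
Proof. by rewrite /Gmx -!scalar_mx_block. Qed.

Lemma GdiagP (g : 'M[R]_N) : Gdiag g <-> exists2 L, L \in unitmx & g = Gmx L.
Proof. by []. Qed.

Lemma Gdiag1 : Gdiag (1%:M : 'M[R]_N).
Proof. by apply/GdiagP; exists 1%:M; rewrite ?unitmx1// Gmx1. Qed.

Lemma Gdiag_mul (g h : 'M[R]_N) : Gdiag g -> Gdiag h -> Gdiag (g *m h).
Proof.
move=> /GdiagP[L Lu ->] /GdiagP[L' Lu' ->]; apply/GdiagP; exists (L *m L').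
  by rewrite unitmx_mul Lu.
exact: Gmx_mulmx.
Qed.

Lemma Gmx_inv (L : 'M[R]_n) : L \in unitmx -> invmx (Gmx L) = Gmx (invmx L).
Proof.
move=> Lu; have e : Gmx (invmx L) *m Gmx L = 1%:M by rewrite Gmx_mulmx mulVmx// Gmx1.
have [_ gu] := mulmx1_unit e.
by rewrite -[RHS](mulmxK gu) e mul1mx.
Qed.

Lemma Gdiag_inv (g : 'M[R]_N) : Gdiag g -> Gdiag (invmx g).
Proof.
move=> /GdiagP[L Lu ->]; rewrite Gmx_inv//; apply/GdiagP; exists (invmx L) => //.
by rewrite unitmx_inv.
Qed.

Lemma gdiag_conj (g : 'M[R]_N) L : Gdiag g ->
  exists L', g *m gdiag L *m invmx g = gdiag L'.
Proof.
move=> /GdiagP[L' Lu ->]; rewrite Gmx_inv//; exists (L' *m L *m invmx L').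
by rewrite /Gmx /gdiag !(mulmx_block, mulmx0, mul0mx, mul1mx, mulmx1, addr0, add0r).
Qed.

Context {T : lmodType R}.
Implicit Types (u : 'I_N -> T) (B g h : 'M[R]_N).

Lemma frame_act_mul u g h : frame_act (frame_act u g) h = frame_act u (g *m h).
Proof.
by apply/funext => k; rewrite -[LHS]fcomb_delta -[RHS]fcomb_delta !fcomb_act mulmxA.
Qed.

Lemma frame_endo_actr u B g : linear_frame u -> g \in unitmx ->
  frame_endo (frame_act u g) B = frame_endo u (g *m B *m invmx g).
Proof.
move=> lu gu; rewrite -(frame_endo_act _ lu gu); congr frame_endo.
by rewrite !mulmxA mulVmx// mul1mx mulmxKV.
Qed.

Lemma frame_endo_sum u (I : finType) (k : I -> R) (B : I -> 'M[R]_N) v : linear_frame u ->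
  \sum_i k i *: frame_endo u (B i) v = frame_endo u (\sum_i k i *: B i) v.
Proof.
move=> lu; have [c ->] := frame_surj v lu; rewrite frame_endoE// mulmx_suml fcomb_sum.
by apply: eq_bigr => i _; rewrite frame_endoE// -scalemxAl fcombZ.
Qed.

End AdjointAlgebra.

Section AdjointBundle.
Context {R : realType} {M : topologicalType} {n : nat} {A : atlas R M n}.
Hypothesis hM : smooth_manifold A.
Let hA := manifold_differentiable_atlas hM.
Let hA1 := atlas1_differentiable hM.
Context {sigma : jet A 1 -> jet A 2}.
Hypothesis hsigma : is_sode sigma.
Local Notation A1 := (atlas1 A).
Local Notation J := (jet A 1).
Local Notation N := (1 + (n + n))%N.
Local Notation lie B := (lie_algebra (@Gdiag R n) B).
Implicit Types (xi : J) (B : 'M[R]_N).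

Lemma exists_chart1 xi : exists a, dom A1 a xi.
Proof. exact: (mfd_cover hM (jpoint xi)). Qed.

Lemma adapted_sode_frame a xi u : dom A1 a xi -> adapted sigma (xi := xi) u ->
  exists2 g, Gdiag g & u = frame_act (sode_frame sigma a xi) g.
Proof.
move=> axi [lu u0 up um].
apply: (adapted_Gdiag (sode_splitting_frame hM hsigma axi)) => //.
by rewrite u0 sode_frame0.
Qed.

Lemma adP_frame a xi E : dom A1 a xi -> adP sigma xi E <->
  exists L, E = frame_endo (sode_frame sigma a xi) (gdiag L).
Proof.
move=> axi; have S := sode_splitting_frame hM hsigma axi.
split=> [|[L ->]]; first exact: (split_endo_gdiag S).
exact: (gdiag_split_endo S).
Qed.

Lemma adapted_linear_frame xi u : adapted sigma (xi := xi) u -> linear_frame u.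
Proof. by case. Qed.

Lemma adj_class_act xi (u : 'I_N -> tangent A1 xi) B h : Gdiag h ->
  adj_class (frame_act u h) (invmx h *m B *m h) = adj_class u B.
Proof.
move=> Gh; have hu := Gdiag_unit Gh; apply/seteqP; split=> p [g Gg ->].
  have gu := Gdiag_unit Gg.
  exists (h *m g); first exact: Gdiag_mul.
  by rewrite frame_act_mul invmx_mul// !mulmxA.
exists (invmx h *m g); first by apply: Gdiag_mul => //; exact: Gdiag_inv.
have gu := Gdiag_unit Gg.
rewrite frame_act_mul mulKVmx// invmx_mul ?unitmx_inv// invmxK.
by rewrite !mulmxA !(mulmxK hu).
Qed.

Lemma adj_fiberE xi (c : adj_fiber sigma xi) : exists u B,
  [/\ adapted sigma u, lie B, adj_cls c = adj_class u B & adj_endo sigma c = frame_endo u B].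
Proof.
rewrite /adj_endo; case: cid => -[u B] [/= hu hB cE].
by exists u, B.
Qed.

Lemma adj_class_refl xi (u : 'I_N -> tangent A1 xi) B : adj_class u B (u, B).
Proof.
by exists 1%:M; [exact: Gdiag1|rewrite frame_act1 invmx1 mul1mx mulmx1].
Qed.

(** The endomorphism is computed from a chosen representative of the class; any other
   one differs from it by an element of the group. *)
Lemma adj_endo_class xi (c : adj_fiber sigma xi) u B : 
  adj_cls c = adj_class u B -> adj_endo sigma c = frame_endo u B.
Proof.
have [u' [B' [hu' _ -> ->]]] := adj_fiberE c; move=> E.
have [g Gg [-> ->]] : adj_class u' B' (u, B) by rewrite E; exact: adj_class_refl.
rewrite frame_endo_act//; first exact: adapted_linear_frame hu'.
exact: Gdiag_unit.
Qed.

Lemma adj_endo_mk xi u B (hu : adapted sigma (xi := xi) u) (hB : lie B) :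
  adj_endo sigma (adj_mk hu hB) = frame_endo u B.
Proof. exact: adj_endo_class. Qed.

Lemma adj_fiber_eq xi (c c' : adj_fiber sigma xi) : adj_cls c = adj_cls c' -> c = c'.
Proof.
case: c c' => [s sP] [s' sP'] /= ss'; subst s'.
by congr AdjFiber; exact: Prop_irrelevance.
Qed.

Lemma adj_endo_adP xi (c : adj_fiber sigma xi) : adP sigma xi (adj_endo sigma c).
Proof.
have [a axi] := exists_chart1 xi.
have [u [B [hu /lie_algebra_GdiagP[L ->] _ ->]]] := adj_fiberE c.
have [g Gg ->] := adapted_sode_frame axi hu.
apply/(adP_frame _ axi); have [L' LE] := gdiag_conj L Gg; exists L'.
rewrite -LE frame_endo_actr//; first exact: (sode_frame_linear_frame hM hsigma).
exact: Gdiag_unit.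
Qed.

(** Two adapted frames differ by some [h] in the group, and equality of the
   endomorphisms then says that the matrices are conjugate by the same [h]. *)
Lemma adj_endo_inj xi : injective (@adj_endo R M n A sigma xi).
Proof.
move=> c c'; have [a axi] := exists_chart1 xi.
have lu := sode_frame_linear_frame hM hsigma axi.
have [u [B [hu hB cE ->]]] := adj_fiberE c.
have [u' [B' [hu' hB' cE' ->]]] := adj_fiberE c'.
have [g Gg uE] := adapted_sode_frame axi hu.
have [g' Gg' uE'] := adapted_sode_frame axi hu'.
have gu := Gdiag_unit Gg.
pose h := invmx g *m g'.
have Gh : Gdiag h by apply: Gdiag_mul => //; exact: Gdiag_inv.
have hu1 := Gdiag_unit Gh.
have u'E : u' = frame_act u h by rewrite uE uE' frame_act_mul mulKVmx.
clearbody h.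
have lu' := adapted_linear_frame hu.
rewrite u'E frame_endo_actr// => /(frame_endo_inj lu') BE.
apply: adj_fiber_eq; rewrite cE cE' u'E BE.
apply: etrans (esym (adj_class_act u (h *m B' *m invmx h) Gh)) _.
by rewrite !mulmxA mulVmx// mul1mx mulmxKV.
Qed.

Lemma adj_endo_bij xi :
  set_bij [set: adj_fiber sigma xi] (adP sigma xi) (@adj_endo R M n A sigma xi).
Proof.
split; first by move=> c _; exact: adj_endo_adP.
- by move=> c c' _ _; exact: adj_endo_inj.
- move=> E; have [a axi] := exists_chart1 xi.
  move=> /(adP_frame _ axi)[L ->].
  have hu := sode_frame_adapted hM hsigma axi.
  have hB : lie (gdiag L) by apply/lie_algebra_GdiagP; exists L.
  by exists (adj_mk hu hB) => //; exact: adj_endo_mk.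
Qed.

Lemma sode_frame_smooth_on a (V : set J) : V `<=` dom A1 a -> forall k b,
  smooth_on (chart A1 b @` (V `&` dom A1 b))
    (in_chart A1 b (fun xi => tcoord (sode_frame sigma a xi k) b)).
Proof.
move=> Va k b; apply: smooth_onS (sode_frame_smooth hM hsigma a b k).
by move=> _ [x [/Va ax bx] <-]; exists x.
Qed.

Lemma adP_subbundle : endo_subbundle A1 (adP sigma).
Proof.
exists (n * n)%N => x0; have [a ax0] := exists_chart1 x0.
exists (dom A1 a); split=> //; first exact: dom1_chart_open.
pose L (k : 'I_(n * n)) : 'M[R]_n := vec_mx (delta_mx 0 k).
exists (fun k x => frame_endo (sode_frame sigma a x) (gdiag (L k))).
have LE (c : 'rV[R]_(n * n)) : \sum_k c 0 k *: L k = vec_mx c.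
  rewrite [in RHS](row_sum_delta c) linear_sum.
  by apply: eq_bigr => k _; rewrite linearZ.
split=> [k|x ax].
  apply: (smooth_frame_endo hA1 (@dom1_chart_open _ _ _ _ hM a)).
  - by move=> x ax; exact: (sode_frame_linear_frame hM hsigma).
  - exact: sode_frame_smooth_on.
  - by move=> b; apply: (smooth_in_chart_cst hA1); exact: dom1_chart_open.
have lu := sode_frame_linear_frame hM hsigma ax.
have E (c : 'rV[R]_(n * n)) :
    (fun v => \sum_k c 0 k *: frame_endo (sode_frame sigma a x) (gdiag (L k)) v) =
    frame_endo (sode_frame sigma a x) (gdiag (vec_mx c)).
  by apply/funext => v; rewrite frame_endo_sum// -gdiag_sum LE.
split.
- by move=> c _; rewrite /= E; apply/(adP_frame _ ax); exists (vec_mx c).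
- move=> c c' _ _; rewrite !E => /(frame_endo_inj lu) /eq_block_mx[_ _ _].
  by move=> /eq_block_mx[/(can_inj vec_mxK)].
- move=> F /(adP_frame _ ax)[K ->]; exists (mxvec K) => //.
  by rewrite E mxvecK.
Qed.

Lemma smooth_adj_endo (U : set J) (s : forall xi, adj_fiber sigma xi) :
  smooth_adj_on sigma U s -> smooth_endo_on A1 U (fun xi => adj_endo sigma (s xi)).
Proof.
move=> sU.
have loc x : U x -> exists V (u : forall xi, 'I_N -> tangent A1 xi) (B : J -> 'M[R]_N),
    [/\ chart_open A1 V, V x, V `<=` U,
    forall y, V y -> linear_frame (u y) /\ adj_endo sigma (s y) = frame_endo (u y) (B y) &
    smooth_endo_on A1 V (fun y => frame_endo (u y) (B y))].
  move=> Ux; have [V [Vo Vx VU [u [B [su sB uB]]]]] := sU x Ux.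
  have H y : V y -> linear_frame (u y) /\
      adj_endo sigma (s y) = frame_endo (u y) (B y).
    move=> /uB[hu hB cE]; split; first exact: adapted_linear_frame hu.
    exact: adj_endo_class.
  exists V, u, B; split=> //.
  by apply: (smooth_frame_endo hA1) => // y /H[].
split=> [x Ux|a c].
  have [V [u [B [_ Vx _ H _]]]] := loc x Ux; have [lu ->] := H x Vx.
  exact: frame_endo_linear.
apply: smooth_on_local => _ [x [Ux ax] <-].
have [V [u [B [Vo Vx VU H [_ sE]]]]] := loc x Ux.
exists (chart A1 a @` (V `&` dom A1 a)); first by exists x.
have := sE a c; apply: (smooth_in_chart_eq hA1 (Vo a)) => y /H[_ ->].
by [].
Qed.

(** Over a chart the adapted frame is available, and the matrix of the endomorphism in
   it provides the smooth representative. *)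
Lemma smooth_endo_adj (U : set J) (s : forall xi, adj_fiber sigma xi) :
  chart_open A1 U ->
  smooth_endo_on A1 U (fun xi => adj_endo sigma (s xi)) -> smooth_adj_on sigma U s.
Proof.
move=> Uo [lE sE] x0 Ux0; have [a ax0] := exists_chart1 x0.
have Vo := chart_openI hA1 Uo (@dom1_chart_open _ _ _ _ hM a).
exists (U `&` dom A1 a); split=> //.
have Bex xi : exists B, dom A1 a xi -> lie B /\
    adj_endo sigma (s xi) = frame_endo (sode_frame sigma a xi) B.
  have [axi|nax] := pselect (dom A1 a xi); last by exists 0.
  have /(adP_frame _ axi)[L ->] := adj_endo_adP (s xi).
  by exists (gdiag L) => _; split=> //; apply/lie_algebra_GdiagP; exists L.
have [B BP] := choice Bex.
exists (fun xi => sode_frame sigma a xi), B; split.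
- by move=> k b; apply: sode_frame_smooth_on => x [].
- have lu x : (U `&` dom A1 a) x -> linear_frame (sode_frame sigma a x).
    by move=> [_ ax]; exact: (sode_frame_linear_frame hM hsigma).
  have su k b := sode_frame_smooth_on (@subIsetr _ U (dom A1 a)) k b.
  apply: (smooth_frame_coef hA1 Vo lu su (E := fun xi => adj_endo sigma (s xi))).
    by move=> x [_ /BP[]].
  split=> [x [Ux _]|b c]; first exact: lE.
  by apply: smooth_onS (sE b c) => _ [x [[Ux _] bx] <-]; exists x.
- move=> xi [_ axi]; have [hB BE] := BP xi axi.
  have hu := sode_frame_adapted hM hsigma axi; split=> //.
  suff -> : s xi = adj_mk hu hB by [].
  by apply: adj_endo_inj; rewrite BE adj_endo_mk.
Qed.

End AdjointBundle.
Theorem proposition3p6 (R : realType) (n : nat) (M : topologicalType)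
    (A : atlas R M n) (hM : smooth_manifold A) (cM : connected [set: M])
    (sigma : jet A 1 -> jet A 2) (hsigma : is_sode sigma) :
  (* ad P^sigma is a smooth vector subbundle of T^*(M^1) (x) T(M^1) *)
  endo_subbundle (atlas1 A) (adP sigma) /\
  (* [u, B] |-> u \o B \o u^-1 is well defined on the adjoint bundle *)
  (forall xi u B (hu : adapted sigma (xi := xi) u) (hB : lie_algebra (@Gdiag R n) B),
     adj_endo sigma (adj_mk hu hB) = frame_endo u B) /\
  (* it is linear on the fibres *)
  (forall xi u B C (k : R) (hu : adapted sigma (xi := xi) u)
     (hB : lie_algebra (@Gdiag R n) B) (hC : lie_algebra (@Gdiag R n) C),
     exists hD : lie_algebra (@Gdiag R n) (k *: B + C),
       forall v, adj_endo sigma (adj_mk hu hD) v =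
         k *: adj_endo sigma (adj_mk hu hB) v
         + adj_endo sigma (adj_mk hu hC) v) /\
  (* it maps each fibre bijectively onto that of ad P^sigma *)
  (forall xi, set_bij [set: adj_fiber sigma xi] (adP sigma xi)
     (@adj_endo R M n A sigma xi)) /\
  (* it and its inverse carry smooth local sections to smooth local sections *)
  (forall (U : set (jet A 1)) (s : forall xi, adj_fiber sigma xi),
     chart_open (atlas1 A) U ->
     (smooth_adj_on sigma U s <->
      smooth_endo_on (atlas1 A) U (fun xi => adj_endo sigma (s xi)))).
Proof.
split; first exact: adP_subbundle.
split; first by move=> xi u B hu hB; exact: adj_endo_mk.
split.
  move=> xi u B C k hu hB hC.
  have hD : lie_algebra (@Gdiag R n) (k *: B + C).
    have /lie_algebra_GdiagP[L ->] := hB; have /lie_algebra_GdiagP[L' ->] := hC.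
    by apply/lie_algebra_GdiagP; exists (k *: L + L'); rewrite gdiag_linear.
  exists hD => v; rewrite !adj_endo_mk.
  have lu := adapted_linear_frame hu; have [c ->] := frame_surj v lu.
  by rewrite !frame_endoE// mulmxDl -scalemxAl fcombD fcombZ.
split; first by move=> xi; exact: adj_endo_bij.
move=> U s Uo; split; first exact: smooth_adj_endo.
exact: smooth_endo_adj.
Qed.
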